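(* Let $f:\Omega_1\times\cdots\times\Omega_n\to[0,1]$ be a function on a finite product probability space and assume that for each $i$ the minimum probability of any atom in $\Omega_i$ is at least $\alpha\le 1/2$. Write $K=\log(1/\alpha)$. Further assume that there is a $0<\tau<1/2$ such that $\mathrm{Inf}_i^{\le\log(1/\tau)/K}(f)\le\tau$ for all $i$. Let $\mu=\mathbf{E}[f]$. Then for any $0\le\rho<1$, $$\mathbb{S}_\rho(f)\le\Gamma_\rho(\mu)+\epsilon,\qquad\text{where}\quad \epsilon=O\Bigl(\frac{K}{1-\rho}\Bigr)\cdot\frac{\log\log(1/\tau)}{\log(1/\tau)}.$$
   Context: Each $(\Omega_i,\mu_i)$ is a finite probability space and $\Omega_1\times\cdots\times\Omega_n$ carries the product measure; expectations of $f$ are with respect to this measure. Noise stability: $(T_\rho f)(\omega_1,\dots,\omega_n)=\mathbf{E}[f(\omega_1',\dots,\omega_n')]$, where independently for each $i$, $\omega_i'$ equals $\omega_i$ with probability $\rho$ and is randomly drawn from $\mu_i$ with probability $1-\rho$; then $\mathbb{S}_\rho(f)=\mathbf{E}[f\cdot T_\rho f]$. Low-degree influences: for each $i$ choose an orthonormal basis $X_{i,0}=1,X_{i,1},X_{i,2},\dots$ of the real-valued functions on $\Omega_i$, and expand $f=\sum_\sigma c_\sigma\prod_{i=1}^nX_{i,\sigma_i}$ over multi-indices $\sigma=(\sigma_1,\dots,\sigma_n)$ of nonnegative integers. With $|\sigma|=\#\{i:\sigma_i>0\}$, define $\mathrm{Inf}_i^{\le d}(f)=\sum_{\sigma:\,|\sigma|\le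 d,\ \sigma_i>0}c_\sigma^2$ (this does not depend on the choice of bases). $\Gamma_\rho(\mu)=\mathbf{P}[X\le t,\,Y\le t]$, where $t=\Phi^{-1}(\mu)$, $\Phi$ is the distribution function of a standard Gaussian, and $(X,Y)$ is a centered two-dimensional Gaussian vector with covariance matrix $\begin{pmatrix}1&\rho\\\rho&1\end{pmatrix}$. The $O(\cdot)$ hides an absolute constant.
   Formalization: In ε, log log(1/τ) (natural log) is replaced by max(1, log log(1/τ)): read literally ε is 0 at τ = 1/e and negative above it, where a dictator on one uniform bit with ρ = 1/2 violates the bound (3/8 > 1/3). *)

(* Defs.v *)
From HB Require Import structures.
From mathcomp Require Import all_boot all_order all_algebra.
From mathcomp Require Import all_classical all_reals all_analysis.

Set Implicit Arguments.
Unset Strict Implicit.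
Unset Printing Implicit Defensive.

Import Order.TTheory GRing.Theory Num.Theory.

Local Open Scope classical_set_scope.
Local Open Scope ring_scope.

Section FiniteProductSpaces.
Variables (R : realType) (n : nat) (Omega : 'I_n -> finType).

Definition is_fin_prob (T : finType) (m : T -> R) : Prop :=
  (forall x, 0 <= m x) /\ \sum_x m x = 1.

Definition prod_space := {dffun forall i : 'I_n, Omega i}.

Definition prod_weight (mu : forall i, Omega i -> R) (w : prod_space) : R :=
  \prod_i mu i (w i).

Definition expect (mu : forall i, Omega i -> R) (f : prod_space -> R) : R :=
  \sum_w prod_weight mu w * f w.

(* The law of the rerandomized point w' given w: independently over i, w' i is
   w i with probability rho and a fresh sample of mu i otherwise. *)
Definition noise_kernel (mu : forall i, Omega i -> R) (rho : R)
    (w w' : prod_space) : R :=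
  \prod_i (rho * (w' i == w i)%:R + (1 - rho) * mu i (w' i)).

Definition noise_op (mu : forall i, Omega i -> R) (rho : R)
    (f : prod_space -> R) (w : prod_space) : R :=
  \sum_w' noise_kernel mu rho w w' * f w'.

Definition noise_stability (mu : forall i, Omega i -> R) (rho : R)
    (f : prod_space -> R) : R :=
  expect mu (fun w => f w * noise_op mu rho f w).

(* When m charges every point of T, the real functions on T form a Euclidean
   space of dimension #|T|, so the #|T| orthonormal functions X k form a basis.
   The first of them is required to be the constant 1. *)
Definition is_orthonormal_basis (T : finType) (m : T -> R)
    (X : 'I_#|T| -> T -> R) : Prop :=
  (forall j k, \sum_x m x * (X j x * X k x) = (j == k)%:R) /\
  (forall k, val k = 0%N -> forall x, X k x = 1).

Definition multi_index := {dffun forall i : 'I_n, 'I_#|Omega i|}.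

Definition weight (s : multi_index) : nat := #|[set i | (0 < s i)%N]%SET|.

Definition is_expansion (X : forall i, 'I_#|Omega i| -> Omega i -> R)
    (c : multi_index -> R) (f : prod_space -> R) : Prop :=
  forall w, f w = \sum_s c s * \prod_i X i (s i) (w i).

(* Inf_i^{<= d}(f), in terms of the coefficients c of the expansion of f. *)
Definition low_degree_influence (c : multi_index -> R) (d : R) (i : 'I_n) : R :=
  \sum_(s : multi_index | ((weight s)%:R <= d) && (0 < s i)%N) c s ^+ 2.

End FiniteProductSpaces.

Section GaussianStability.
Variable R : realType.

(* The distribution function of a standard Gaussian on [-oo, +oo], so that it
   is a bijection onto [0, 1]. *)
Definition Phi (s : \bar R) : \bar R :=
  normal_prob (0 : R) 1 [set x : R | (x%:E <= s)%E].

(* In particular Phi_inv 0 = -oo and Phi_inv 1 = +oo. *)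
Definition Phi_inv (m : R) : \bar R := xget 0%E [set s | Phi s = m%:E].

(* With g.1 and g.2 independent standard Gaussians, X = g.1 and
   Y = rho * g.1 + sqrt (1 - rho ^ 2) * g.2 form a centered Gaussian vector
   with unit variances and covariance rho. *)
Definition Gamma (rho m : R) : R :=
  let t := Phi_inv m in
  fine ((normal_prob (0 : R) 1 \x normal_prob (0 : R) 1)%E
    [set g : R * R | (g.1%:E <= t)%E /\
       ((rho * g.1 + Num.sqrt (1 - rho ^+ 2) * g.2)%:E <= t)%E]).

End GaussianStability.

(* The numerator of the error term, with log log (1 / tau) bounded below by 1.
   The two agree for tau <= exp (- e); for larger tau the quantity
   log log (1 / tau) drops to 0 and becomes negative, and as an error bound it
   is meaningful only up to this truncation. *)
Definition loglog_inv (R : realType) (tau : R) : R :=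
  Num.max 1 (ln (ln tau^-1)).

(* Main.v *)
(** Neither the invariance principle nor Borell's theorem is used; the proof is
    an induction on coordinates, in the manner of De, Mossel and Neeman.  Let
    J(x, y) be the probability that X <= Phi^-1(x) and Y <= Phi^-1(y), where X
    and Y are standard Gaussians of correlation rho.  Then J(x, y) >= x y,
    J(x, x) = Gamma_rho(x), and the matrix with rows (J_xx, rho J_xy) and
    (rho J_xy, J_yy) is negative semidefinite.  Hence, for w and w' correlated
    as in the definition of noise stability, averaging one coordinate out of h
    decreases E[J(h(w), h(w'))] by at most a third-order Taylor remainder, that
    is, by the third absolute moment of the corresponding increment of h.

    This is applied to h = e + (1 - 2 e) T_g f.  The shift by e keeps h away
    from 0 and 1, where the third derivatives of J blow up polynomially.  The
    increments of T_g f have small third moments: their high-degree part is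
    damped by T_g, and the third moment of their low-degree part is controlled
    through hypercontractivity by the low-degree influences.  With 1 - g of
    order K log log (1 / tau) / log (1 / tau), the polynomial losses are
    absorbed. *)

Require Import Defs.
From HB Require Import structures.
From mathcomp Require Import all_boot all_order all_algebra.
From mathcomp Require Import all_classical all_reals all_analysis.
From mathcomp Require Import measurable_realfun ring lra.

Set Implicit Arguments.
Unset Strict Implicit.
Unset Printing Implicit Defensive.

Import Order.TTheory GRing.Theory Num.Theory.
Import numFieldNormedType.Exports.

Local Open Scope classical_set_scope.
Local Open Scope ring_scope.

(** * The standard Gaussian distribution *)

(** The third moments summed over all coordinates must not grow with their number. Averaging out a
    coordinate removes exactly the Fourier coefficients whose index is positive there, so each
    coefficient is charged once, provided the bound on a third moment is linear in the squared
    coefficients. Boundedness of the increments gives this at high degree; at low degree, one factor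
    of the influence is spent on smallness and the other is kept.

    Write [L = ln (1/tau)], [l] for the truncated [ln L], [E = exp l] and
    [err = K l / ((1 - rho) L)]. Smoothing costs [2 (1 - g) / (1 - rho)], so [1 - g = 48 K l / L] is
    affordable, and it damps squared coefficients of degree above [L / (12 K)] by [E^-8]. The shift
    [e = 1 / (4 E)] costs [4 e = 1 / E], at most [2 err]. The Taylor constant is of order
    [e^-4 (1 - rho)^-2]. The claim is trivial unless [err] is small, which forces
    [1 / (1 - rho) <= E]; the constant is then of order [E^6], which [E^-8] and [exp (- L / 4)] both
    beat. *)

Section NormalCdf.
Variable R : realType.
Notation mu := (@lebesgue_measure R).

Definition npdf (x : R) : R := normal_pdf 0 1 x.

Lemma npdfE x : npdf x = (Num.sqrt (pi *+ 2))^-1 * expR (- x ^+ 2 / 2).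
Proof.
by rewrite /npdf normal_pdfE ?oner_eq0// /normal_peak /normal_fun subr0 expr1n
  mul1r.
Qed.

Lemma npdf_gt0 x : 0 < npdf x.
Proof.
by rewrite npdfE mulr_gt0 ?expR_gt0// invr_gt0 sqrtr_gt0 mulrn_wgt0// pi_gt0.
Qed.

Lemma npdf_le1 x : npdf x <= 1.
Proof.
have p1 : (Num.sqrt (pi *+ 2 : R))^-1 <= 1.
  have p2 : (1 : R) <= pi *+ 2 by have := @pi_ge2 R; lra.
  rewrite invf_le1 ?sqrtr_gt0; last by lra.
  by rewrite -[leLHS]sqrtr1 ler_wsqrtr.
have e1 : expR (- x ^+ 2 / 2) <= 1 :> R.
  by rewrite -[leRHS]expR0 ler_expR mulNr oppr_le0 mulr_ge0 ?sqr_ge0.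
by rewrite npdfE mulr_ile1 ?expR_ge0 ?invr_ge0.
Qed.

Lemma continuous_npdf : continuous npdf.
Proof. by apply: continuous_normal_pdf; rewrite oner_eq0. Qed.

Lemma is_derive_npdf (x : R) : is_derive x 1 npdf (- x * npdf x).
Proof.
rewrite (_ : npdf = fun x => (Num.sqrt (pi *+ 2))^-1 * expR (- x ^+ 2 / 2)).
  move: (Num.sqrt _)^-1 => c.
  by apply: is_derive_eq; rewrite /GRing.scale/=; set e := expR _; field.
by apply/funext => y; rewrite npdfE.
Qed.

Definition ncdf (s : R) : R := (\int[mu]_(x in `]-oo, s]) npdf x)%R.

Lemma integrable_npdf (D : set R) : measurable D ->
  mu.-integrable D (EFin \o npdf).
Proof.
by move=> mD; apply: (integrableS measurableT) => //; exact: integrable_normal_pdf.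
Qed.

Lemma EFin_ncdf s : (ncdf s)%:E = normal_prob 0 1 `]-oo, s].
Proof.
rewrite /ncdf /Rintegral fineK//.
exact: (fin_num_measure (@normal_prob R 0 1)).
Qed.

Lemma is_derive_ncdf (s : R) : is_derive s 1 ncdf (npdf s).
Proof.
have s1 : s < s + 1 by rewrite ltrDl.
have intf : mu.-integrable `]-oo, s + 1] (EFin \o npdf) by exact: integrable_npdf.
have := continuous_FTC1 s1 intf.
rewrite ltNyr => /(_ isT (@continuous_npdf s)) [d1 d2].
by apply: DeriveDef; [exact: d1|rewrite -derive1E; exact: d2].
Qed.

Lemma ncdf_ge0 s : 0 <= ncdf s.
Proof. by rewrite -lee_fin EFin_ncdf. Qed.

Lemma ncdf_le1 s : ncdf s <= 1.
Proof. by rewrite -lee_fin EFin_ncdf probability_le1. Qed.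

Lemma ncdf_lt x y : x < y -> ncdf x < ncdf y.
Proof.
move=> xy; have [||c _ e] := @MVT R ncdf npdf x y xy.
- by move=> z _; exact: is_derive_ncdf.
- apply: derivable_within_continuous => z _; exact: (@ex_derive _ _ _ _ _ _ _ (is_derive_ncdf z)).
by rewrite -subr_gt0 e mulr_gt0 ?npdf_gt0// subr_gt0.
Qed.

Lemma ncdf_le : {homo ncdf : x y / x <= y}.
Proof. by move=> x y; rewrite le_eqVlt => /orP[/eqP->//|/ncdf_lt/ltW]. Qed.

Lemma ncdf_gt0 s : 0 < ncdf s.
Proof. by apply: le_lt_trans (@ncdf_lt (s - 1) s _); [exact: ncdf_ge0|lra]. Qed.

Lemma ncdf_lt1 s : ncdf s < 1.
Proof. by apply: lt_le_trans (@ncdf_lt s (s + 1) _) (ncdf_le1 _); lra. Qed.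

Lemma continuous_ncdf : continuous ncdf.
Proof.
by move=> x; apply/differentiable_continuous/derivable1_diffP;
  exact: (@ex_derive _ _ _ _ _ _ _ (is_derive_ncdf x)).
Qed.

Let idR : measurableTypeR R -> R := idfun.
#[local] HB.instance Definition _ :=
  @isMeasurableFun.Build _ _ _ _ idR (@measurable_id _ _ setT).
Let idRV : {RV @normal_prob R 0 1 >-> R} := idR.

Lemma ncdf_cvgy : ncdf x @[x --> +oo] --> (1 : R).
Proof.
apply/fine_cvg => /=.
exact: (@cvg_cdfy1 _ _ _ _ idRV).
Qed.

Lemma ncdf_cvgNy : ncdf x @[x --> -oo] --> (0 : R).
Proof.
apply/fine_cvg => /=.
exact: (@cvg_cdfNy0 _ _ _ _ idRV).
Qed.

Lemma ncdf_surj x : 0 < x < 1 -> exists s, ncdf s = x.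
Proof.
move=> /andP[x0 x1].
have [a ax] : exists a, ncdf a < x.
  have : \forall a \near -oo, ncdf a < x by exact: (cvgr_lt 0 ncdf_cvgNy).
  case=> M [Mr MP].
  by exists (M - 1); apply: MP; lra.
have [b bx] : exists b, x < ncdf b.
  have : \forall b \near +oo, x < ncdf b by exact: (cvgr_gt 1 ncdf_cvgy).
  by case=> M [Mr MP]; exists (M + 1); apply: MP; lra.
have ab : a <= b.
  by rewrite leNgt; apply/negP => /ncdf_lt; rewrite ltNge => /negP; apply; lra.
have [||c _ cx] := @IVT R ncdf a b x ab.
- by apply: continuous_subspaceT; exact: continuous_ncdf.
- by rewrite minEle maxEle; case: ifP; lra.
by exists c.
Qed.

End NormalCdf.

(** * Monotonicity, mean values and a chain rule in two variables *)

Section MonotoneByDerivative.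
Variable R : realType.

Lemma is_derive_continuous (f : R -> R) (x d : R) :
  is_derive x 1 f d -> {for x, continuous f}.
Proof.
by case=> fd _; apply/differentiable_continuous/derivable1_diffP.
Qed.

Lemma is_derive_ge0_le (f df : R -> R) (a b : R) :
  (forall x, a <= x <= b -> is_derive x 1 f (df x)) ->
  (forall x, a <= x <= b -> 0 <= df x) -> a <= b -> f a <= f b.
Proof.
move=> fdf df0; rewrite le_eqVlt => /orP[/eqP->//|ab].
have [||c /[!in_itv]/= /andP[ac cb] e] := @MVT R f df a b ab.
- by move=> z /[!in_itv]/= /andP[az zb]; apply: fdf; rewrite !ltW.
- apply: derivable_within_continuous => z /[!in_itv]/= zab.
  exact: (@ex_derive _ _ _ _ _ _ _ (fdf z zab)).
rewrite -subr_ge0 e mulr_ge0//; first by apply: df0; rewrite !ltW.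
by rewrite subr_ge0 ltW.
Qed.

Lemma is_derive_le0_le (f df : R -> R) (a b : R) :
  (forall x, a <= x <= b -> is_derive x 1 f (df x)) ->
  (forall x, a <= x <= b -> df x <= 0) -> a <= b -> f b <= f a.
Proof.
move=> fdf df0 ab; rewrite -lerN2.
apply: (@is_derive_ge0_le (fun x => - f x) (fun x => - df x)) => // x xab.
  by have := fdf _ xab => ?; exact: is_deriveN.
by rewrite oppr_ge0 df0.
Qed.

Lemma MVT_between (f df : R -> R) (a b : R) :
  (forall x : R, is_derive x 1 f (df x)) ->
  exists2 c, `|c - a| <= `|b - a| & f b - f a = df c * (b - a).
Proof.
move=> fdf.
have cf A : {within A, continuous f}.
  by apply: continuous_subspaceT => x; exact: is_derive_continuous (fdf x).
have [ab|ba|->] := ltgtP a b; last by exists b; rewrite ?subrr ?mulr0.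
- have [|c /[!in_itv]/= /andP[ac cb] e] := @MVT R f df a b ab; first exact: cf.
  by exists c => //; rewrite !ger0_norm ?subr_ge0 ?(ltW ac) ?(ltW ab)// lerB// ltW.
- have [|c /[!in_itv]/= /andP[bc ca] e] := @MVT R f df b a ba; first exact: cf.
  exists c; last by rewrite -opprB e -mulrN opprB.
  by rewrite !ler0_norm ?subr_le0 ?(ltW ca) ?(ltW ba)// lerN2 lerB// ltW.
Qed.

(** Moving the second argument first leaves a one-variable composition at fixed [a x]. The change in
    the first argument is a value of [P] at an intermediate point [xi z], by the mean value theorem,
    and joint continuity of [P] gives the limit. Both pieces are in Caratheodory form, so they add
    up. *)
Lemma is_derive_comp2 (F P : R -> R -> R) (a b : R -> R) (x ds dt Q : R) :
  (forall s t : R, is_derive s 1 (F ^~ t) (P s t)) ->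
  is_derive (b x) 1 (F (a x)) Q ->
  {for (a x, b x), continuous (fun z => P z.1 z.2)} ->
  is_derive x 1 a ds -> is_derive x 1 b dt ->
  is_derive x 1 (fun y => F (a y) (b y)) (P (a x) (b x) * ds + Q * dt).
Proof.
move=> FP FQ cP da db.
have ca := is_derive_continuous da; have cb := is_derive_continuous db.
have dF2 : is_derive x 1 (fun y => F (a x) (b y)) (Q * dt).
  exact: is_derive1_comp.
have /is_derive1_caratheodory[al [alE cal alx]] := da.
have /is_derive1_caratheodory[be [beE cbe bex]] := dF2.
have /choice[xi xiP] z : exists c, `|c - a x| <= `|a z - a x| /\
    F (a z) (b z) - F (a x) (b z) = P c (b z) * (a z - a x).
  have [c c1 c2] := @MVT_between (F ^~ (b z)) (P ^~ (b z)) (a x) (a z)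
    (fun s => FP s (b z)).
  by exists c.
have xix : xi x = a x.
  have [] := xiP x; rewrite subrr normr0 normr_le0 subr_eq0 => /eqP-> //.
apply/is_derive1_caratheodory; exists (fun z => P (xi z) (b z) * al z + be z).
split; last by rewrite xix alx bex.
- move=> z; rewrite mulrDl -beE -mulrA -alE -(xiP z).2; ring.
- have cxi : {for x, continuous xi}.
    apply/cvgrPdist_le => e e0.
    move/cvgrPdist_le : ca => /(_ e e0); apply: filterS => z.
    rewrite xix distrC => ze; rewrite distrC; apply: le_trans ze.
    by have [] := xiP z.
  apply: cvgD => //; apply: cvgM => //.
  apply: (@continuous_comp _ _ _ (fun z => (xi z, b z)) (fun z => P z.1 z.2)).
    exact: (cvg_pair cxi cb).
  by rewrite /= xix.
Qed.

End MonotoneByDerivative.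

(** * Gaussian tails compared with the density *)

Section NormalTail.
Variable R : realType.
Implicit Types s x : R.

Lemma ncdf_small x (d : R) : 0 < d -> exists2 y, y <= x & ncdf y < d.
Proof.
move=> d0.
have : \forall a \near -oo, ncdf a < d by exact: (cvgr_lt 0 (@ncdf_cvgNy R)).
case=> M [Mr MP]; exists (Order.min x (M - 1)); first by rewrite ge_min lexx.
by apply: MP; rewrite gt_min; apply/orP; right; lra.
Qed.

Lemma ncdf_large x (d : R) : d < 1 -> exists2 y, x <= y & d < ncdf y.
Proof.
move=> d0.
have : \forall a \near +oo, d < ncdf a by exact: (cvgr_gt 1 (@ncdf_cvgy R)).
case=> M [Mr MP]; exists (Order.max x (M + 1)); first by rewrite le_max lexx.
by apply: MP; rewrite lt_max; apply/orP; right; lra.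
Qed.

(** On this half-line [npdf - ncdf] has derivative [(- z - 1) npdf z >= 0], and [ncdf] tends to 0 at
    minus infinity. *)
Lemma ncdf_le_npdf s : s <= -1 -> ncdf s <= npdf s.
Proof.
move=> s1; rewrite leNgt; apply/negP => ns.
have [y ys yn] : exists2 y, y <= s & ncdf y < ncdf s - npdf s.
  by apply: ncdf_small; rewrite subr_gt0.
suff : npdf y - ncdf y <= npdf s - ncdf s by have := npdf_gt0 y; lra.
apply: (@is_derive_ge0_le _ (fun z => npdf z - ncdf z)
  (fun z => - z * npdf z - npdf z)) => // z /andP[_ zs].
  by have ? := is_derive_npdf z; have ? := is_derive_ncdf z; exact: is_deriveB.
by have := npdf_gt0 z; nra.
Qed.

Lemma onem_ncdf_le_npdf s : 1 <= s -> 1 - ncdf s <= npdf s.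
Proof.
move=> s1; rewrite leNgt; apply/negP => ns.
have [y ys yn] : exists2 y, s <= y & ncdf s + npdf s < ncdf y.
  by apply: ncdf_large; lra.
suff : npdf y + ncdf y <= npdf s + ncdf s by have := npdf_gt0 y; lra.
apply: (@is_derive_le0_le _ (fun z => npdf z + ncdf z)
  (fun z => - z * npdf z + npdf z)) => // z /andP[zs _].
  by have ? := is_derive_npdf z; have ? := is_derive_ncdf z; exact: is_deriveD.
by have := npdf_gt0 z; nra.
Qed.

(** This bounds the derivatives of the quantile function on [[e, 1 - e]]: outside [[-1, 1]] the
    density dominates the tail, which is at least [e], and inside it is at least [npdf 1]. *)
Lemma npdf_ge_tail s (e : R) : 0 < e ->
  e <= ncdf s <= 1 - e -> npdf 1 * e <= npdf s.
Proof.
move=> e0 /andP[es se]; have p1 := @npdf_le1 R 1; have p0 := @npdf_gt0 R 1.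
have e1 : e <= 1 by lra.
have [s1|s1] := lerP s (-1).
  by have := ncdf_le_npdf s1; nra.
have [s2|s2] := lerP 1 s.
  by have := onem_ncdf_le_npdf s2; nra.
have : npdf 1 <= npdf s; last by nra.
have q0 : 0 < (Num.sqrt (pi *+ 2 : R))^-1.
  by rewrite invr_gt0 sqrtr_gt0 mulrn_wgt0// pi_gt0.
by rewrite !npdfE (ler_pM2l q0) ler_expR; nra.
Qed.

(** Since [|s| <= 1 + s^2 / 2 <= exp (s^2 / 2)]. A lower bound on the density at a quantile thus
    bounds the quantile itself. *)
Lemma normr_le_npdf s : npdf s * `|s| <= 1.
Proof.
have h : expR (s ^+ 2 / 2) * npdf s <= 1.
  rewrite npdfE mulrCA -expRD mulNr addrN expR0 mulr1.
  by have := @npdf_le1 R 0; rewrite npdfE expr0n/= oppr0 mul0r expR0 mulr1.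
have h2 : `|s| <= expR (s ^+ 2 / 2).
  apply: le_trans (expR_ge1Dx _); rewrite -real_normK ?num_real//.
  by have := normr_ge0 s; move: `|s| => y; nra.
by apply: le_trans h; rewrite mulrC ler_pM2r ?npdf_gt0.
Qed.

End NormalTail.

(** * The bivariate Gaussian distribution function *)

Section BivariateNormal.
Variables (R : realType) (rho kap : R).
Hypotheses (rho0 : 0 <= rho) (kap0 : 0 < kap) (kap2 : kap ^+ 2 = 1 - rho ^+ 2).
Notation mu := (@lebesgue_measure R).

Definition cpdf (u w : R) : R := npdf ((w - rho * u) / kap) / kap.

Lemma cpdf_ge0 u w : 0 <= cpdf u w.
Proof. by rewrite divr_ge0 ?ltW ?npdf_gt0. Qed.

(** Both sides are the joint density of the pair: the exponent is [- (u^2 - 2 rho u w + w^2) / (2 (1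
    - rho^2))]. *)
Lemma joint_npdfC u w : npdf u * cpdf u w = npdf w * cpdf w u.
Proof.
rewrite /cpdf !mulrA; congr (_ / _); rewrite !npdfE.
move: (Num.sqrt _)^-1 => c.
rewrite mulrACA [RHS]mulrACA; congr (_ * _); rewrite -!expRD; congr expR.
rewrite !expr_div_n kap2.
have k0 : 1 - rho ^+ 2 != 0 by rewrite -kap2 expf_neq0 ?gt_eqF.
by field.
Qed.

Lemma is_derive_affine (a b x : R) : is_derive x 1 (fun w : R => (w - a) / b) b^-1.
Proof.
by apply: is_derive_eq; rewrite /GRing.scale/= !mulr0 add0r subr0 mulr1.
Qed.

Lemma is_derive_caffine (a b c x : R) :
  is_derive x 1 (fun u : R => (a - b * u) / c) (- b / c).
Proof. by apply: is_derive_eq; rewrite /GRing.scale/=; lra. Qed.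

Lemma continuous_cpdf u : continuous (cpdf u).
Proof.
move=> w; apply: cvgMl.
apply: (@continuous_comp _ _ _ (fun w => (w - rho * u) / kap) (@npdf R)).
  exact: is_derive_continuous (is_derive_affine _ _ _).
exact: continuous_npdf.
Qed.

Lemma integral_cpdf u t :
  (\int[mu]_(w in `]-oo, t]) (cpdf u w)%:E = (ncdf ((t - rho * u) / kap))%:E)%E.
Proof.
rewrite EFin_ncdf /normal_prob.
pose F (w : R) : R := (w - rho * u) / kap.
have dF (w : R) : is_derive w 1 F kap^-1 by exact: is_derive_affine.
have F'E : (F^`())%classic = cst kap^-1.
  by apply/funext => w; rewrite derive1E derive_val.
rewrite (@increasing_ge0_integration_by_substitutionNy _ F (normal_pdf 0 1) t).
- by apply: eq_integral => w _; rewrite /= F'E.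
- by move=> x y _ _ xy; rewrite /F ltr_pM2r ?invr_gt0// ltrD2r.
- by rewrite F'E => w _; exact: cvg_cst.
- by rewrite F'E; exact: is_cvg_cst.
- by rewrite F'E; exact: cvg_cst.
- split; first by move=> w _; exact: (@ex_derive _ _ _ _ _ _ _ (dF w)).
  by apply: cvg_at_left_filter; exact: is_derive_continuous (dF t).
- by apply/gt0_cvgMlNy; [rewrite invr_gt0|exact: cvg_addrr_Ny].
- by apply: continuous_subspaceT; exact: continuous_npdf.
- by move=> x _; exact: normal_pdf_ge0.
Qed.

(* P[X <= s, Y <= t] for Y = rho X + kap Z with X and Z independent standard
   Gaussians, conditioning on X. *)
Definition bncdf (s t : R) : R :=
  (\int[mu]_(u in `]-oo, s]) (npdf u * ncdf ((t - rho * u) / kap)))%R.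

Lemma continuous_bncdf_integrand t :
  continuous (fun u => npdf u * ncdf ((t - rho * u) / kap)).
Proof.
move=> u; apply: cvgM; first exact: continuous_npdf.
apply: (@continuous_comp _ _ _ (fun u => (t - rho * u) / kap) (@ncdf R)).
  exact: is_derive_continuous (is_derive_caffine _ _ _ _).
exact: continuous_ncdf.
Qed.

Lemma integrable_bncdf_integrand t (D : set R) : measurable D ->
  mu.-integrable D (EFin \o (fun u => npdf u * ncdf ((t - rho * u) / kap))).
Proof.
move=> mD; apply: (@le_integrable _ _ _ mu D mD _ (EFin \o (@npdf R))).
- apply/measurable_EFinP/measurable_funTS.
  by apply: continuous_measurable_fun; exact: continuous_bncdf_integrand.
- move=> u _; rewrite lee_fin !ger0_norm ?mulr_ge0 ?ncdf_ge0// ?(ltW (npdf_gt0 _))//.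
  by rewrite ler_piMr ?ncdf_le1// ltW ?npdf_gt0.
- exact: integrable_npdf.
Qed.

Lemma EFin_bncdf s t : (bncdf s t)%:E =
  (\int[mu]_(u in `]-oo, s]) (npdf u * ncdf ((t - rho * u) / kap))%:E)%E.
Proof.
rewrite /bncdf /Rintegral fineK//; apply: integrable_fin_num => //.
exact: integrable_bncdf_integrand.
Qed.

Let joint_itv (s t u w : R) : R :=
  \1_`]-oo, s] u * \1_`]-oo, t] w * (npdf u * cpdf u w).

Let integral_joint_itv s t u : (\int[mu]_w (joint_itv s t u w)%:E =
  (\1_`]-oo, s] u * (npdf u * ncdf ((t - rho * u) / kap)))%:E)%E.
Proof.
rewrite mulrA EFinM -integral_cpdf [in RHS]integral_mkcond/=.
rewrite -ge0_integralZl//.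
- apply: eq_integral => w _; rewrite patchE /joint_itv indicE.
  rewrite [\1_`]-oo, t] w]indicE; case: ifPn => wt/=.
    by rewrite mulr1 -EFinM mulrA.
  by rewrite mulr0 mul0r mule0.
- apply/(measurable_restrictT _ _).1 => //.
  apply/measurable_EFinP/measurable_funTS.
  by apply: continuous_measurable_fun; exact: continuous_cpdf.
- by move=> w _; rewrite patchE; case: ifP => //; rewrite lee_fin cpdf_ge0.
- by rewrite lee_fin mulr_ge0 ?indicE ?ler0n// ltW ?npdf_gt0.
Qed.

Let bncdf_joint_itv s t :
  ((bncdf s t)%:E = \int[mu]_u \int[mu]_w (joint_itv s t u w)%:E)%E.
Proof.
rewrite EFin_bncdf integral_mkcond; apply: eq_integral => u _.
rewrite integral_joint_itv patchE indicE.
by case: ifPn => us/=; rewrite ?mul1r ?mul0r.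
Qed.

(** Conditioning on the first variable breaks the symmetry; Tonelli and the symmetric joint density
    restore it. The derivative in the second argument then follows from the one in the first,
    without differentiating under the integral. *)
Lemma bncdfC s t : bncdf s t = bncdf t s.
Proof.
apply: EFin_inj; apply: etrans (bncdf_joint_itv s t) _; apply: esym.
apply: etrans (bncdf_joint_itv t s) _; apply: esym.
rewrite (@fubini_tonelli _ _ _ _ _ mu mu (fun z => (joint_itv s t z.1 z.2)%:E))/=.
- apply: eq_integral => w _; apply: eq_integral => u _.
  by rewrite /joint_itv joint_npdfC [X in X * _]mulrC.
- apply/measurable_EFinP; apply: measurable_funM.
    apply: measurable_funM.
      have mi : measurable_fun setT (\1_`]-oo, s]%classic : R -> R) by [].
      exact: (measurableT_comp mi).
    have mi : measurable_fun setT (\1_`]-oo, t]%classic : R -> R) by [].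
    exact: (measurableT_comp mi).
  apply: measurable_funM.
    by apply: measurableT_comp => //; exact: measurable_normal_pdf.
  apply: measurable_funM => //.
  apply: (measurableT_comp (f := @npdf R)); first exact: measurable_normal_pdf.
  by apply: measurable_funM => //; apply: measurable_funB => //; apply: measurable_funM.
- move=> z; rewrite lee_fin; apply: mulr_ge0.
    by rewrite mulr_ge0 ?indicE ?ler0n.
  by rewrite mulr_ge0 ?cpdf_ge0// ltW ?npdf_gt0.
Qed.

End BivariateNormal.

Section BivariateNormalTheory.
Variables (R : realType) (rho kap : R).
Hypotheses (rho0 : 0 <= rho) (kap0 : 0 < kap) (kap2 : kap ^+ 2 = 1 - rho ^+ 2).
Notation mu := (@lebesgue_measure R).
Notation bncdf := (bncdf rho kap).

Lemma is_derive_bncdfl (s t : R) :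
  is_derive s 1 (bncdf ^~ t) (npdf s * ncdf ((t - rho * s) / kap)).
Proof.
have s1 : s < s + 1 by rewrite ltrDl.
have intf : mu.-integrable `]-oo, s + 1]
  (EFin \o (fun u => npdf u * ncdf ((t - rho * u) / kap))).
  exact: integrable_bncdf_integrand.
have := continuous_FTC1 s1 intf.
rewrite ltNyr => /(_ isT (@continuous_bncdf_integrand _ rho kap t s)) [d1 d2].
by apply: DeriveDef; [exact: d1|rewrite -derive1E; exact: d2].
Qed.

Lemma is_derive_bncdfr (s t : R) :
  is_derive t 1 (bncdf s) (npdf t * ncdf ((s - rho * t) / kap)).
Proof.
have -> : bncdf s = bncdf ^~ s by apply/funext => y; exact: bncdfC.
exact: is_derive_bncdfl.
Qed.

Lemma bncdf_ge0 s t : 0 <= bncdf s t.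
Proof.
by apply: Rintegral_ge0 => u _; rewrite mulr_ge0 ?ncdf_ge0// ltW ?npdf_gt0.
Qed.

(** As [rho >= 0], the conditional probability is smallest at the endpoint [u = s]. The bound serves
    to control the joint distribution function when one argument is large. *)
Lemma ncdfM_le_bncdf s t : ncdf s * ncdf ((t - rho * s) / kap) <= bncdf s t.
Proof.
rewrite mulrC /ncdf -RintegralZl//; last exact: integrable_npdf.
apply: le_Rintegral => //.
- rewrite (_ : _ \o _ =
    fun u => ((ncdf ((t - rho * s) / kap))%:E * (npdf u)%:E)%E)//.
  by apply: integrableZl => //; exact: integrable_npdf.
- exact: integrable_bncdf_integrand.
- move=> u /=; rewrite in_itv/= => us; rewrite mulrC ler_pM2l ?npdf_gt0//.
  apply: ncdf_le; rewrite ler_pM2r ?invr_gt0// lerB// ler_wpM2l//; exact: ltW.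
Qed.

(* The difference of the two sides, as a function of s, vanishes at both
   infinities, and its derivative changes sign at most once, from + to -. *)
Lemma bncdf_ge_ncdfM s t : ncdf s * ncdf t <= bncdf s t.
Proof.
pose D s := bncdf s t - ncdf s * ncdf t.
pose dD s := npdf s * (ncdf ((t - rho * s) / kap) - ncdf t).
have dDE (x : R) : is_derive x 1 D (dD x).
  have ? := is_derive_bncdfl x t; have ? := is_derive_ncdf x.
  by apply: is_derive_eq; rewrite /GRing.scale/= /dD; ring.
suff : 0 <= D s by rewrite subr_ge0.
rewrite leNgt; apply/negP => Ds.
(* [(t - rho x) / kap] decreases in [x], so a nonnegative derivative of [D] at [s] persists to the
   left and a negative one stays nonpositive to the right. In either direction [D] remains at most
   [D s < 0], against its limit 0. *)
have [c|c] := lerP t ((t - rho * s) / kap).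
  have [|y ys yD] := @ncdf_small R s (- D s); first by rewrite oppr_gt0.
  suff : D y <= D s.
    have := bncdf_ge0 y t; have := ncdf_ge0 y; have := ncdf_ge0 t.
    have := ncdf_le1 t; rewrite /D in yD *; nra.
  apply: (@is_derive_ge0_le _ D dD) => // x /andP[_ xs].
  rewrite mulr_ge0 ?subr_ge0 ?(ltW (npdf_gt0 _))//; apply: ncdf_le.
  by apply: le_trans c _; rewrite ler_pM2r ?invr_gt0// lerB// ler_wpM2l//; exact: ltW.
(* At the point [y = kap z + rho t] one has [(y - rho t) / kap = z], so the swapped crude bound
   gives [D y >= ncdf t * (ncdf z - ncdf y) >= ncdf z - 1 > D s]. *)
have [|z zs zD] := @ncdf_large R ((s - rho * t) / kap) (1 + D s).
  by rewrite gtrDl.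
have sy : s <= kap * z + rho * t.
  by rewrite -lerBlDr [kap * z]mulrC -ler_pdivrMr.
suff : D (kap * z + rho * t) <= D s.
  have := ncdfM_le_bncdf t (kap * z + rho * t); rewrite addrK.
  rewrite [kap * z]mulrC mulfK ?gt_eqF// -bncdfC//.
  have := ncdf_ge0 t; have := ncdf_le1 t; have := ncdf_le1 z.
  have := ncdf_le1 (z * kap + rho * t).
  rewrite /D in zD *; nra.
apply: (@is_derive_le0_le _ D dD) => // x /andP[sx _].
rewrite pmulr_rle0 ?npdf_gt0// subr_le0; apply: ncdf_le.
by apply: le_trans (ltW c); rewrite ler_pM2r ?invr_gt0// lerB// ler_wpM2l//; exact: ltW.
Qed.

Lemma is_derive_bncdf_comp (a b : R -> R) (x ds dt : R) :
  is_derive x 1 a ds -> is_derive x 1 b dt ->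
  is_derive x 1 (fun y => bncdf (a y) (b y))
    (npdf (a x) * ncdf ((b x - rho * a x) / kap) * ds +
     npdf (b x) * ncdf ((a x - rho * b x) / kap) * dt).
Proof.
pose P s t := npdf s * ncdf ((t - rho * s) / kap).
apply: (@is_derive_comp2 _ bncdf P) => [s t||z].
- exact: is_derive_bncdfl.
- exact: is_derive_bncdfr.
- apply: cvgM.
    apply: (@continuous_comp _ _ _ fst (@npdf R)); first exact: cvg_fst.
    exact: continuous_npdf.
  apply: (@continuous_comp _ _ _ (fun z => (z.2 - rho * z.1) / kap) (@ncdf R)).
    apply: cvgMl; apply: cvgB; first exact: cvg_snd.
    by apply: cvgMr; exact: cvg_fst.
  exact: continuous_ncdf.
Qed.

End BivariateNormalTheory.

(** * Third-order expansion in quantile coordinates *)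

Section NormalQuantile.
Variable R : realType.

(** The upper bound on the third derivative is integrated three times, each time as monotonicity of
    a polynomial minus the function. *)
Lemma taylor2_le (q q1 q2 q3 : R -> R) (M : R) :
  (forall x : R, 0 <= x <= 1 -> is_derive x 1 q (q1 x)) ->
  (forall x : R, 0 <= x <= 1 -> is_derive x 1 q1 (q2 x)) ->
  (forall x : R, 0 <= x <= 1 -> is_derive x 1 q2 (q3 x)) ->
  (forall x : R, 0 <= x <= 1 -> q3 x <= M) ->
  q 1 <= q 0 + q1 0 + q2 0 / 2 + M / 6.
Proof.
move=> d1 d2 d3 q3M.
have r2 x : 0 <= x <= 1 -> 0 <= q2 0 + M * x - q2 x.
  move=> /andP[x0 x1].
  have y01 y : 0 <= y <= x -> 0 <= y <= 1.
    by move=> /andP[-> /le_trans]; apply.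
  suff : q2 0 + M * 0 - q2 0 <= q2 0 + M * x - q2 x by lra.
  apply: (@is_derive_ge0_le R (fun x => q2 0 + M * x - q2 x) (fun x => M - q3 x)).
  - move=> y /y01/d3 ?.
    by apply: is_derive_eq; rewrite /GRing.scale/=; ring.
  - by move=> y /y01/q3M; lra.
  - exact: x0.
have r1 x : 0 <= x <= 1 -> 0 <= q1 0 + q2 0 * x + M * x ^+ 2 / 2 - q1 x.
  move=> /andP[x0 x1].
  have y01 y : 0 <= y <= x -> 0 <= y <= 1.
    by move=> /andP[-> /le_trans]; apply.
  suff : q1 0 + q2 0 * 0 + M * 0 ^+ 2 / 2 - q1 0 <=
    q1 0 + q2 0 * x + M * x ^+ 2 / 2 - q1 x by rewrite expr0n/=; lra.
  apply: (@is_derive_ge0_le R (fun x => q1 0 + q2 0 * x + M * x ^+ 2 / 2 - q1 x)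
    (fun x => q2 0 + M * x - q2 x)).
  - move=> y /y01/d2 ?.
    by apply: is_derive_eq; rewrite /GRing.scale/=; field.
  - by move=> y /y01/r2.
  - exact: x0.
suff : q 0 + q1 0 * 0 + q2 0 * 0 ^+ 2 / 2 + M * 0 ^+ 3 / 6 - q 0 <=
    q 0 + q1 0 * 1 + q2 0 * 1 ^+ 2 / 2 + M * 1 ^+ 3 / 6 - q 1.
  by rewrite !expr0n/= !expr1n; lra.
apply: (@is_derive_ge0_le R
  (fun x => q 0 + q1 0 * x + q2 0 * x ^+ 2 / 2 + M * x ^+ 3 / 6 - q x)
  (fun x => q1 0 + q2 0 * x + M * x ^+ 2 / 2 - q1 x)).
- move=> y /d1 ?.
  by apply: is_derive_eq; rewrite /GRing.scale/=; field.
- exact: r1.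
- exact: ler01.
Qed.

(** A real-valued quantile with default 0 outside the open unit interval. It differs there from
    [Phi_inv], so means equal to 0 or 1 are treated apart. *)
Definition ninv (x : R) : R := xget 0 [set s | ncdf s = x].

Lemma ninvK x : 0 < x < 1 -> ncdf (ninv x) = x.
Proof.
move=> /ncdf_surj[s sx]; exact: (@xgetPex _ 0 [set s | ncdf s = x] (ex_intro _ s sx)).
Qed.

Lemma ncdf_inj : injective (@ncdf R).
Proof.
by move=> x y xy; have [/ncdf_lt|/ncdf_lt|//] := ltgtP x y; rewrite xy ltxx.
Qed.

Lemma ncdfK : cancel (@ncdf R) ninv.
Proof. by move=> s; apply: ncdf_inj; rewrite ninvK// ncdf_gt0 ncdf_lt1. Qed.

Lemma is_derive_ninv (x : R) : 0 < x < 1 -> is_derive x 1 ninv (npdf (ninv x))^-1.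
Proof.
move=> x01; rewrite -{1}(ninvK x01).
apply: (@is_derive_inverse _ (@ncdf R)).
- by near=> y; exact: ncdfK.
- by near=> y; exact: continuous_ncdf.
- exact: is_derive_ncdf.
- by rewrite gt_eqF ?npdf_gt0.
Unshelve. all: by end_near. Qed.

End NormalQuantile.

(** * Taylor expansion of the joint distribution function along a segment *)

Section Curve.
Variables (R : realType) (rho kap : R).
Hypotheses (rho0 : 0 <= rho) (rho1 : rho < 1)
  (kap0 : 0 < kap) (kap2 : kap ^+ 2 = 1 - rho ^+ 2).
Notation bncdf := (bncdf rho kap).

Variables (e x0 y0 U V : R).
Hypotheses (e0 : 0 < e).
Hypothesis curve_x : forall h : R, 0 <= h <= 1 -> e <= x0 + h * U <= 1 - e.
Hypothesis curve_y : forall h : R, 0 <= h <= 1 -> e <= y0 + h * V <= 1 - e.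

Let s h := ninv (x0 + h * U).
Let t h := ninv (y0 + h * V).
Let ds h := U / npdf (s h).
Let dt h := V / npdf (t h).
Let A h := (t h - rho * s h) / kap.
Let B h := (s h - rho * t h) / kap.
Let p h := npdf (s h) * npdf (A h).

Let is_derive_quantile (z0 W h : R) : e <= z0 + h * W <= 1 - e ->
  is_derive h 1 (fun h : R => ninv (z0 + h * W)) (W / npdf (ninv (z0 + h * W))).
Proof.
move=> /andP[z1 z2].
have z01 : 0 < z0 + h * W < 1 by apply/andP; split; [exact: lt_le_trans z1|apply: le_lt_trans z2 _; rewrite ltrBlDr ltrDl].
have d : is_derive (z0 + h * W) 1 (@ninv R) (npdf (ninv (z0 + h * W)))^-1.
  exact: is_derive_ninv.
have da : is_derive h 1 (fun h : R => z0 + h * W) W.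
  by apply: is_derive_eq; rewrite /GRing.scale/=; ring.
have := @is_derive1_comp _ (@ninv R) (fun h => z0 + h * W) h _ _ d da.
by rewrite mulrC.
Qed.

Let is_derive_s (h : R) : 0 <= h <= 1 -> is_derive h 1 s (ds h).
Proof. by move=> /curve_x; exact: is_derive_quantile. Qed.

Let is_derive_t (h : R) : 0 <= h <= 1 -> is_derive h 1 t (dt h).
Proof. by move=> /curve_y; exact: is_derive_quantile. Qed.

Let is_derive_quotient (W : R) (z : R -> R) (h : R) :
  is_derive h 1 z (W / npdf (z h)) ->
  is_derive h 1 (fun h : R => W / npdf (z h)) (z h * (W / npdf (z h)) ^+ 2).
Proof.
move=> dz.
have dn := @is_derive1_comp _ (@npdf R) z h _ _ (is_derive_npdf (z h)) dz.
have n0 : npdf (z h) != 0 by rewrite gt_eqF ?npdf_gt0.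
have dv := @is_deriveV _ (@npdf R \o z) h _ 1 n0 dn.
apply: is_derive_eq; rewrite /GRing.scale/=.
by move: (npdf (z h)) n0 => n n0; field.
Qed.

Let is_derive_A (h : R) : 0 <= h <= 1 -> is_derive h 1 A ((dt h - rho * ds h) / kap).
Proof.
move=> h01; have ? := is_derive_s h01; have ? := is_derive_t h01.
by apply: is_derive_eq; rewrite /GRing.scale/=; lra.
Qed.

Let is_derive_B (h : R) : 0 <= h <= 1 -> is_derive h 1 B ((ds h - rho * dt h) / kap).
Proof.
move=> h01; have ? := is_derive_s h01; have ? := is_derive_t h01.
by apply: is_derive_eq; rewrite /GRing.scale/=; lra.
Qed.

(** Each product is [kap] times the joint density at [(s h, t h)]. This lets the two halves of the
    second derivative share the factor [p]. *)
Let pE h : npdf (t h) * npdf (B h) = p h.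
Proof.
have := @joint_npdfC R rho kap kap0 kap2 (s h) (t h).
rewrite /cpdf !mulrA => /(congr1 (fun z => z * kap)).
by rewrite !divfK ?gt_eqF.
Qed.

Let q h := bncdf (s h) (t h).
Let q1 h := U * ncdf (A h) + V * ncdf (B h).
(* In the coordinates s = Phi^-1(x) and t = Phi^-1(y) the second derivative of
   J along a segment only involves s', t' and p, since s'' = s s'^2. *)
Let q2 h := p h / kap * (2 * ds h * dt h - rho * (ds h ^+ 2 + dt h ^+ 2)).
Let dp h := p h * (- (s h * ds h) - A h * ((dt h - rho * ds h) / kap)).
Let q3 h := dp h / kap * (2 * ds h * dt h - rho * (ds h ^+ 2 + dt h ^+ 2))
  + p h / kap * (2 * (s h * ds h ^+ 2 * dt h + t h * ds h * dt h ^+ 2)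
    - 2 * rho * (s h * ds h ^+ 3 + t h * dt h ^+ 3)).

Let npdf_neq0 x : npdf x != 0 :> R.
Proof. by rewrite gt_eqF ?npdf_gt0. Qed.

Let is_derive_q (h : R) : 0 <= h <= 1 -> is_derive h 1 q (q1 h).
Proof.
move=> h01; have ? := is_derive_s h01; have ? := is_derive_t h01.
apply: is_derive_eq; first exact: is_derive_bncdf_comp.
rewrite -/(A h) -/(B h) /q1 /ds /dt; field.
by rewrite !npdf_neq0.
Qed.

Let is_derive_q1 (h : R) : 0 <= h <= 1 -> is_derive h 1 q1 (q2 h).
Proof.
move=> h01; have dA := is_derive_A h01; have dB := is_derive_B h01.
have ? := @is_derive1_comp _ (@ncdf R) A h _ _ (is_derive_ncdf (A h)) dA.
have ? := @is_derive1_comp _ (@ncdf R) B h _ _ (is_derive_ncdf (B h)) dB.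
apply: is_derive_eq; rewrite /GRing.scale/= /q2.
have Us : U = ds h * npdf (s h) by rewrite /ds divfK.
have Vt : V = dt h * npdf (t h) by rewrite /dt divfK.
rewrite [X in X * _]Us [X in _ + X * _]Vt.
transitivity (ds h * p h * ((dt h - rho * ds h) / kap) +
  dt h * p h * ((ds h - rho * dt h) / kap)).
  by rewrite -[in X in _ = _ + X]pE /p; ring.
by have k0 := lt0r_neq0 kap0; field.
Qed.

Let is_derive_q2 (h : R) : 0 <= h <= 1 -> is_derive h 1 q2 (q3 h).
Proof.
move=> h01; have dA := is_derive_A h01; have ? := is_derive_s h01.
have ? := is_derive_t h01.
have ? := @is_derive1_comp _ (@npdf R) A h _ _ (is_derive_npdf (A h)) dA.
have ? := @is_derive1_comp _ (@npdf R) s h _ _ (is_derive_npdf (s h)) (is_derive_s h01).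
have ? : is_derive h 1 ds (s h * ds h ^+ 2) by apply: is_derive_quotient; exact: is_derive_s.
have ? : is_derive h 1 dt (t h * dt h ^+ 2) by apply: is_derive_quotient; exact: is_derive_t.
have ? : is_derive h 1 p (dp h).
  apply: is_derive_eq; rewrite /GRing.scale/=.
  by rewrite /dp /p; lra.
apply: is_derive_eq; rewrite /GRing.scale/= /q3; lra.
Qed.

Let c := npdf 1 * e.
Let S := c^-1.
Let k := kap^-1.
Let W : R := `|U| + `|V|.

Let c_gt0 : 0 < c. Proof. by rewrite mulr_gt0 ?npdf_gt0. Qed.

Let quantile_le (z : R) : e <= z <= 1 - e -> `|ninv z| <= S.
Proof.
move=> /andP[z1 z2]; have z01 : 0 < z < 1.
  by apply/andP; split; [exact: lt_le_trans z1|apply: le_lt_trans z2 _; rewrite ltrBlDr ltrDl].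
have cz : c <= npdf (ninv z) by apply: npdf_ge_tail; rewrite // ninvK ?z1.
rewrite /S -[c^-1]mul1r ler_pdivlMr// mulrC.
by apply: le_trans (normr_le_npdf (ninv z)); rewrite ler_wpM2r.
Qed.

Let quotient_le (z Z : R) : e <= z <= 1 - e -> `|Z| <= W ->
  `|Z / npdf (ninv z)| <= W * S.
Proof.
move=> /andP[z1 z2] ZW; have z01 : 0 < z < 1.
  by apply/andP; split; [exact: lt_le_trans z1|apply: le_lt_trans z2 _; rewrite ltrBlDr ltrDl].
have cz : c <= npdf (ninv z) by apply: npdf_ge_tail; rewrite // ninvK ?z1.
rewrite normrM ler_pM// ger0_norm ?invr_ge0 ?(ltW (npdf_gt0 _))//.
by rewrite /S lef_pV2 ?posrE ?npdf_gt0.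
Qed.

Let q3_le (h : R) : 0 <= h <= 1 -> q3 h <= 28 * W ^+ 3 * S ^+ 4 * k ^+ 3.
Proof.
move=> h01; apply: le_trans (ler_norm _) _.
have nM (x y X Y : R) : `|x| <= X -> `|y| <= Y -> `|x * y| <= X * Y :> R.
  by move=> ? ?; rewrite normrM ler_pM.
have nX n (x X : R) : `|x| <= X -> `|x ^+ n| <= X ^+ n :> R.
  by move=> xX; rewrite normrX lerXn2r ?nnegrE// (le_trans _ xX).
have nD (x y X Y : R) : `|x| <= X -> `|y| <= Y -> `|x + y| <= X + Y :> R.
  by move=> ? ?; rewrite (le_trans (ler_normD _ _))// lerD.
have nN (x X : R) : `|x| <= X -> `|- x| <= X :> R by rewrite normrN.
have n2 : `|2| <= 2 :> R by rewrite ger0_norm.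
have nr : `|rho| <= 1 by rewrite ger0_norm// ltW.
have nk : `|kap^-1| <= k by rewrite ger0_norm// invr_ge0 ltW.
have ns : `|s h| <= S by apply: quantile_le; exact: curve_x.
have nt : `|t h| <= S by apply: quantile_le; exact: curve_y.
have nds : `|ds h| <= W * S.
  by apply: quotient_le; [exact: curve_x|rewrite /W lerDl].
have ndt : `|dt h| <= W * S.
  by apply: quotient_le; [exact: curve_y|rewrite /W lerDr].
have np : `|p h| <= 1.
  rewrite ger0_norm ?mulr_ge0 ?(ltW (npdf_gt0 _))//.
  by rewrite mulr_ile1 ?npdf_le1 ?(ltW (npdf_gt0 _)).
have nA := nM _ _ _ _ (nD _ _ _ _ nt (nN _ _ (nM _ _ _ _ nr ns))) nk.
have ndp := nM _ _ _ _ np (nD _ _ _ _ (nN _ _ (nM _ _ _ _ ns nds)) (nN _ _ (nM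
  _ _ _ _ nA (nM _ _ _ _ (nD _ _ _ _ ndt (nN _ _ (nM _ _ _ _ nr nds))) nk)))).
have nq := nD _ _ _ _ (nM _ _ _ _ (nM _ _ _ _ n2 nds) ndt) (nN _ _ (nM _ _ _ _
  nr (nD _ _ _ _ (nX 2 _ _ nds) (nX 2 _ _ ndt)))).
have nc := nD _ _ _ _ (nM _ _ _ _ n2 (nD _ _ _ _ (nM _ _ _ _ (nM _ _ _ _ ns
  (nX 2 _ _ nds)) ndt) (nM _ _ _ _ (nM _ _ _ _ nt nds) (nX 2 _ _ ndt)))) (nN _
  _ (nM _ _ _ _ (nM _ _ _ _ n2 nr) (nD _ _ _ _ (nM _ _ _ _ ns (nX 3 _ _ nds))
  (nM _ _ _ _ nt (nX 3 _ _ ndt))))).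
apply: le_trans (nD _ _ _ _ (nM _ _ _ _ (nM _ _ _ _ ndp nk) nq)
  (nM _ _ _ _ (nM _ _ _ _ np nk) nc)) _.
(* The factorwise bounds add up to [(12 k + 16 k^3) W^3 S^4]; [k >= 1] turns this into
   [28 k^3 W^3 S^4]. *)
have k1 : 1 <= k.
  have k2 : kap ^+ 2 <= 1 by rewrite kap2 lerBlDr lerDl sqr_ge0.
  by rewrite invf_ge1// -(@expr_le1 _ 2)// ltW.
have kk : k <= k ^+ 3 by rewrite ler_eXnr.
have S0 : 0 <= S by rewrite invr_ge0 ltW.
have W0 : 0 <= W by rewrite addr_ge0.
have : 0 <= 12 * (W ^+ 3 * S ^+ 4) * (k ^+ 3 - k).
  by rewrite mulr_ge0 ?subr_ge0// mulr_ge0// mulr_ge0 ?exprn_ge0.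
move=> H; rewrite -subr_ge0; apply: (le_trans H).
by rewrite le_eqVlt; apply/orP; left; apply/eqP; ring.
Qed.

Lemma bncdf_quantile_taylor :
  bncdf (ninv (x0 + U)) (ninv (y0 + V)) <=
  bncdf (ninv x0) (ninv y0)
  + (U * ncdf ((ninv y0 - rho * ninv x0) / kap) +
     V * ncdf ((ninv x0 - rho * ninv y0) / kap))
  + npdf (ninv x0) * npdf ((ninv y0 - rho * ninv x0) / kap) / kap *
    (2 * (U / npdf (ninv x0)) * (V / npdf (ninv y0)) -
     rho * ((U / npdf (ninv x0)) ^+ 2 + (V / npdf (ninv y0)) ^+ 2)) / 2
  + 28 * (`|U| + `|V|) ^+ 3 * (npdf 1 * e)^-1 ^+ 4 * kap^-1 ^+ 3 / 6.
Proof.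
have := taylor2_le is_derive_q is_derive_q1 is_derive_q2 q3_le.
by rewrite /q /q1 /q2 /p /A /B /ds /dt /s /t !mul1r !mul0r !addr0.
Qed.

End Curve.

(** * Gaussian noise stability *)

Section GammaBivariate.
Variable R : realType.
Notation mu := (@lebesgue_measure R).
Notation P := (@normal_prob R 0 1).

Lemma integral_normal_prob (f : R -> \bar R) : measurable_fun setT f ->
  (\int[P]_x `|f x| < +oo)%E ->
  (\int[P]_x f x = \int[mu]_x (f x * (npdf x)%:E))%E.
Proof.
move=> mf finf; have dom := @normal_prob_dominates R 0 1.
rewrite -(Radon_Nikodym_change_of_variables dom)//=; last exact/integrableP.
have mn : measurable_fun setT (fun x : R => (npdf x)%:E).
  by apply/measurable_EFinP; exact: measurable_normal_pdf.
apply: ae_eq_integral => //.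
- exact: emeasurable_funM.
- exact: emeasurable_funM.
apply: ae_eqe_mul2l; rewrite Radon_NikodymE//=.
case: cid => /= h [h1 h2 h3]; apply: integral_ae_eq => //.
by move=> E _ mE; rewrite -h3.
Qed.

Lemma PhiE (s : R) : Phi s%:E = (ncdf s)%:E.
Proof.
by rewrite EFin_ncdf; congr (normal_prob _ _ _).
Qed.

Lemma Phi_inv_fin (m : R) : 0 < m < 1 -> Phi_inv m = (ninv m)%:E.
Proof.
move=> /[dup] m01 /andP[m0 m1]; rewrite /Phi_inv.
have := @xgetPex _ 0%E [set s | Phi s = m%:E].
move=> /(_ (ex_intro _ (ninv m)%:E _)) /=.
rewrite PhiE ninvK// => /(_ erefl).
case: xget => [r||].
- by rewrite PhiE => -[<-]; rewrite ncdfK.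
- rewrite /Phi (_ : [set _ | _] = setT) ?probability_setT.
    by move=> [m1']; rewrite -m1' ltxx in m1.
  by apply/seteqP; split => x //= _; rewrite leey.
- rewrite /Phi (_ : [set _ | _] = set0) ?measure0.
    by move=> [m0']; rewrite -m0' ltxx in m0.
  by apply/seteqP; split => x //=; rewrite leeNy_eq.
Qed.

Lemma Phi_inv1 : Phi_inv (1 : R) = +oo%E.
Proof.
have Phiy : Phi +oo%E = 1%:E :> \bar R.
  rewrite /Phi (_ : [set _ | _] = setT) ?probability_setT//.
  by apply/seteqP; split => x //= _; rewrite leey.
have := @xgetPex _ 0%E [set s | Phi s = 1%:E :> \bar R] (ex_intro _ _ Phiy).
rewrite /Phi_inv /=; case: xget => [r|//|].
  by rewrite PhiE => -[r1]; have := ncdf_lt1 r; rewrite r1 ltxx.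
rewrite /Phi (_ : [set _ | _] = set0) ?measure0.
  by move=> [/esym/eqP]; rewrite oner_eq0.
by apply/seteqP; split => x //=; rewrite leeNy_eq.
Qed.

Lemma Gamma1 (rho : R) : Gamma rho 1 = 1.
Proof.
rewrite /Gamma Phi_inv1 (_ : [set _ | _] = setT).
  transitivity (fine (P setT * P setT)%E); last by rewrite probability_setT mule1.
  by congr fine; rewrite -setXTT; exact: product_measure1E.
by apply/seteqP; split => x //= _; rewrite !leey.
Qed.

Lemma Gamma_ge0 (rho m : R) : 0 <= Gamma rho m.
Proof. by rewrite fine_ge0. Qed.

(** For [x <= t] the section at [x] of the event defining [Gamma] is the half-line up to
    [(t - rho x) / kap], whose probability is the conditional factor in [bncdf]. *)
Lemma Gamma_bncdf (rho m : R) : 0 <= rho < 1 -> 0 < m < 1 ->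
  Gamma rho m = bncdf rho (Num.sqrt (1 - rho ^+ 2)) (ninv m) (ninv m).
Proof.
move=> /andP[rho0 rho1] m01; rewrite /Gamma Phi_inv_fin//.
set t := ninv m; set kap := Num.sqrt _.
have kap0 : 0 < kap by rewrite sqrtr_gt0 subr_gt0 expr_lt1.
rewrite [X in fine X](_ : _ = (bncdf rho kap t t)%:E)//.
rewrite /product_measure1 EFin_bncdf//.
pose g x : R := \1_`]-oo, t] x * ncdf ((t - rho * x) / kap).
have g0 x : 0 <= g x by rewrite mulr_ge0 ?ncdf_ge0// indicE.
have mg : measurable_fun setT (EFin \o g).
  apply/measurable_EFinP; apply: measurable_funM => //.
  apply: continuous_measurable_fun => u.
  apply: (@continuous_comp _ _ _ (fun u => (t - rho * u) / kap) (@ncdf R)).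
    exact: is_derive_continuous (is_derive_caffine _ _ _ _).
  exact: continuous_ncdf.
transitivity (\int[P]_x (g x)%:E)%E.
  apply: eq_integral => x _; rewrite /= /g indicE.
  rewrite (_ : xsection _ x = if x <= t then `]-oo, (t - rho * x) / kap]%classic
    else set0).
    rewrite mem_setE in_itv/=; case: ifPn => xt; last by rewrite measure0 mul0r.
    by rewrite mul1r EFin_ncdf.
  apply/seteqP; split => y; rewrite /xsection/= inE/= lee_fin.
    move=> [-> ]; rewrite lee_fin /= in_itv/= ler_pdivlMr//; lra.
  case: ifP => //= xt; rewrite in_itv/= ler_pdivlMr// => h.
  by split => //; rewrite lee_fin; lra.
rewrite integral_normal_prob//; last first.
  apply: (@le_lt_trans _ _ (\int[P]_x 1)%E); last first.
    by rewrite integral_cst// mul1e (le_lt_trans (probability_le1 P measurableT))// ltry.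
  apply: ge0_le_integral => //; first exact: measurableT_comp.
  move=> x _; rewrite lee_fin ger0_norm// /g indicE.
  by case: (_ \in _); rewrite ?mul0r ?mul1r ?ncdf_le1.
rewrite [RHS]integral_mkcond/=; apply: eq_integral => x _.
rewrite patchE -EFinM /g indicE.
by case: ifPn; rewrite ?mul0r// mul1r mulrC.
Qed.

End GammaBivariate.

(** * A Bellman function with a cubic Taylor remainder *)

Section BellmanFunction.
Variable R : realType.

(* A second-order Taylor bound with cubic remainder, whose quadratic form is
   nonpositive once its mixed term is multiplied by the correlation rho. *)
Definition step_bound (Psi : R -> R -> R) (rho M : R) : Prop :=
  forall a b, 0 <= a <= 1 -> 0 <= b <= 1 ->
  exists P Q F11 F12 F22 : R,
    (forall u v, F11 * u ^+ 2 + 2 * rho * F12 * (u * v) + F22 * v ^+ 2 <= 0) /\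
    (forall u v, 0 <= a + u <= 1 -> 0 <= b + v <= 1 ->
      Psi (a + u) (b + v) <= Psi a b + P * u + Q * v +
        (F11 * u ^+ 2 + 2 * F12 * (u * v) + F22 * v ^+ 2) / 2 +
        M * (`|u| ^+ 3 + `|v| ^+ 3)).

(** Along the diagonal the densities cancel and the derivative is twice a value of [ncdf], hence
    between 0 and 2. It bounds the cost of the shift by [e] in [Gamma]. *)
Lemma bncdf_diag_lip (rho kap m m' : R) : 0 <= rho -> 0 < kap ->
  kap ^+ 2 = 1 - rho ^+ 2 -> 0 < m < 1 -> 0 < m' < 1 ->
  bncdf rho kap (ninv m') (ninv m') <=
  bncdf rho kap (ninv m) (ninv m) + 2 * `|m' - m|.
Proof.
move=> rho0 kap0 kap2 /andP[m0 m1] /andP[m0' m1'].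
have aux (a b c d : R) : a - 2 * c <= b - 2 * d -> a <= b + 2 * (c - d) by lra.
have aux2 (a : R) : a <= 1 -> a + a - 2 <= 0 by lra.
pose J x := bncdf rho kap (ninv x) (ninv x).
pose A x := ncdf ((ninv x - rho * ninv x) / kap).
have dJ (x : R) : 0 < x < 1 -> is_derive x 1 J (A x + A x).
  move=> x01; have dn := is_derive_ninv x01.
  apply: is_derive_eq; first exact: is_derive_bncdf_comp.
  rewrite -/(A x); have : npdf (ninv x) != 0 by rewrite gt_eqF ?npdf_gt0.
  by move=> n0; field.
rewrite -/(J m) -/(J m').
have [mm|mm] := lerP m m'.
  apply: aux.
  apply: (@is_derive_le0_le _ (fun x => J x - 2 * x) (fun x => A x + A x - 2)) => //.
    move=> x /andP[mx xm].
    have x01 : 0 < x < 1 by rewrite (lt_le_trans m0)// (le_lt_trans xm).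
    have ? := dJ x x01.
    by apply: is_derive_eq; rewrite /GRing.scale/=; ring.
  by move=> x _; apply: aux2; exact: ncdf_le1.
apply: (@le_trans _ _ (J m)); last by rewrite lerDl mulr_ge0 ?subr_ge0 ?(ltW mm).
apply: (@is_derive_ge0_le _ J (fun x => A x + A x)); last exact: ltW.
  move=> x /andP[mx xm]; apply: dJ.
  by rewrite (lt_le_trans m0')// (le_lt_trans xm).
by move=> x _; rewrite addr_ge0 ?ncdf_ge0.
Qed.

Lemma gaussian_bellman : exists2 C : R, 0 < C &
  forall rho e : R, 0 <= rho < 1 -> 0 < e <= 1 / 4 ->
  exists Psi : R -> R -> R,
  [/\ step_bound Psi rho (C / (e ^+ 4 * (1 - rho) ^+ 2)),
      forall x y, 0 <= x <= 1 -> 0 <= y <= 1 -> x * y <= Psi x y + 2 * e &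
      forall m, 0 < m < 1 -> Psi m m <= Gamma rho m + 2 * e].
Proof.
(* The Taylor remainder has the factor [28 / 6], and [(|u| + |v|)^3] costs another 4:
   [56 / 3 <= 19]. *)
exists (19 * (npdf 1)^-1 ^+ 4) => [|rho e rho01 /andP[e0 e4]].
  by rewrite mulr_gt0// exprn_gt0// invr_gt0 npdf_gt0.
have /andP[rho0 rho1] := rho01.
pose kap : R := Num.sqrt (1 - rho ^+ 2).
have r2 : 0 < 1 - rho ^+ 2 by rewrite subr_gt0 expr_lt1.
have kap0 : 0 < kap by rewrite sqrtr_gt0.
have kap2 : kap ^+ 2 = 1 - rho ^+ 2 by rewrite sqr_sqrtr ?ltW.
pose tr x := e + (1 - 2 * e) * x.
have trP x : 0 <= x <= 1 -> e <= tr x <= 1 - e.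
  by move=> /andP[x0 x1]; rewrite /tr; apply/andP; split; nra.
have tr01 x : 0 <= x <= 1 -> 0 < tr x < 1.
  move=> /trP/andP[x0 x1]; rewrite (lt_le_trans e0)// (le_lt_trans x1)//.
  by rewrite ltrBlDr ltrDl.
exists (fun x y => bncdf rho kap (ninv (tr x)) (ninv (tr y))); split.
- move=> a b a01 b01.
  have aux (W n k uv r : R) : 0 <= n -> 0 <= uv * r -> W * k <= 4 * uv * r ->
      28 * W * n * k / 6 <= 19 * n * r * uv.
    move=> n0 r0 h; have : 0 <= n * (19 * (uv * r) - 28 / 6 * (W * k)).
      by rewrite mulr_ge0//; lra.
    by nra.
  pose s := ninv (tr a); pose t := ninv (tr b).
  pose c := npdf s * npdf ((t - rho * s) / kap) / kap.
  have c0 : 0 <= c by rewrite divr_ge0 ?mulr_ge0 ?(ltW (npdf_gt0 _))// ltW.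
  pose l := 1 - 2 * e.
  (* These are the partial derivatives of the shifted function, with [l] from the chain rule.
     Weighting the mixed term by [rho] completes the square: the form becomes
     [- rho c (l u / npdf s - l v / npdf t)^2]. *)
  exists (l * ncdf ((t - rho * s) / kap)), (l * ncdf ((s - rho * t) / kap)).
  exists (- rho * c * (l / npdf s) ^+ 2), (c * (l / npdf s) * (l / npdf t)).
  exists (- rho * c * (l / npdf t) ^+ 2); split=> u v.
    have : 0 <= rho * c * (l / npdf s * u - l / npdf t * v) ^+ 2.
      by rewrite mulr_ge0 ?sqr_ge0// mulr_ge0.
    rewrite -oppr_le0 => H; apply: le_trans H; rewrite le_eqVlt; apply/orP; left;
      apply/eqP; ring.
  move=> au bv.
  have curve z w h : 0 <= z <= 1 -> 0 <= z + w <= 1 -> 0 <= h <= 1 ->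
      e <= tr z + h * (l * w) <= 1 - e.
    move=> /andP[z0 z1] /andP[w0 w1] /andP[h0 h1].
    have -> : tr z + h * (l * w) = tr (z + h * w) by rewrite /tr /l; ring.
    by apply: trP; apply/andP; split; nra.
  have := @bncdf_quantile_taylor R rho kap rho0 rho1 kap0 kap2 e (tr a) (tr b)
    (l * u) (l * v) e0 (fun h => curve a u h a01 au) (fun h => curve b v h b01 bv).
  have trD z w : tr z + l * w = tr (z + w) by rewrite /tr /l; ring.
  rewrite !trD => /le_trans; apply.
  rewrite -/s -/t -/c !addrA; apply: lerD.
    rewrite le_eqVlt; apply/orP; left; apply/eqP.
    rewrite -/s -/t -/c; move: (bncdf _ _ _ _) (ncdf _) (ncdf _) => B N1 N2.
    by field; rewrite !gt_eqF ?npdf_gt0.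
  have l01 : 0 <= l <= 1 by rewrite /l; apply/andP; split; lra.
  have W3 : (`|l * u| + `|l * v|) ^+ 3 <= 4 * (`|u| ^+ 3 + `|v| ^+ 3).
    have nl w : `|l * w| <= `|w|.
      by case/andP: l01 => l0 l1; rewrite normrM ger0_norm// ler_piMl.
    apply: (@le_trans _ _ ((`|u| + `|v|) ^+ 3)).
      by rewrite lerXn2r ?nnegrE ?addr_ge0// lerD.
    rewrite -subr_ge0 (_ : _ - _ = 3 * (`|u| + `|v|) * (`|u| - `|v|) ^+ 2).
      by rewrite mulr_ge0 ?sqr_ge0// mulr_ge0// addr_ge0.
    ring.
  (* Since [kap <= 1], [kap^3 >= kap^4 = (1 - rho^2)^2 >= (1 - rho)^2]. *)
  have k3 : kap^-1 ^+ 3 <= (1 - rho) ^- 2.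
    rewrite exprVn lef_pV2 ?posrE ?exprn_gt0 ?subr_gt0//.
    have kap1 : kap <= 1.
      by rewrite -(@expr_le1 _ 2) ?(ltW kap0)// kap2 lerBlDr lerDl sqr_ge0.
    apply: (@le_trans _ _ (kap ^+ 4)); last first.
      by rewrite [leLHS]exprS ler_piMl// exprn_ge0// ltW.
    rewrite (_ : kap ^+ 4 = (1 - rho ^+ 2) ^+ 2); last by rewrite -kap2 -exprM.
    by rewrite lerXn2r ?nnegrE ?subr_ge0 ?(ltW rho1) ?(ltW r2)//; nra.
  have S4 : (npdf 1 * e)^-1 ^+ 4 = (npdf 1)^-1 ^+ 4 * e ^- 4 :> R.
    by rewrite invfM exprMn [e^-1 ^+ 4]exprVn.
  rewrite S4; set n4 := (npdf 1)^-1 ^+ 4; set e4' := e ^- 4.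
  have -> : 19 * n4 / (e ^+ 4 * (1 - rho) ^+ 2) = 19 * n4 * e4' * (1 - rho) ^- 2.
    by rewrite invfM mulrA.
  have n40 : 0 <= n4 * e4'.
    by rewrite mulr_ge0 ?exprn_ge0 ?invr_ge0 ?exprn_ge0 ?(ltW e0) ?(ltW (npdf_gt0 _)).
  have uv0 : 0 <= `|u| ^+ 3 + `|v| ^+ 3 by rewrite addr_ge0 ?exprn_ge0.
  have W0 : 0 <= (`|l * u| + `|l * v|) ^+ 3 by rewrite exprn_ge0 ?addr_ge0.
  have k0 : 0 <= kap^-1 ^+ 3 by rewrite exprn_ge0 ?invr_ge0 ?(ltW kap0).
  rewrite -[19 * n4 * e4']mulrA; apply: aux => //.
    by rewrite mulr_ge0// invr_ge0 sqr_ge0.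
  exact: ler_pM W0 k0 W3 k3.
- move=> x y x01 y01.
  have := @bncdf_ge_ncdfM R rho kap rho0 kap0 kap2 (ninv (tr x)) (ninv (tr y)).
  rewrite !ninvK ?tr01//; move: (bncdf _ _ _ _) => B; rewrite /tr.
  move=> hB; rewrite -lerBlDr; apply: le_trans hB; case/andP: x01 => x0 x1; case/andP: y01 => y0 y1.
  have p1 : x * y <= 1 by rewrite mulr_ile1.
  (* The difference [tr x * tr y + 2 e - x y] is [e] times an affine function of [e]. It is
     interpolated between its values at [e = 0] and [e = 1 / 4], which are the expressions of [h0]
     and [h1]. *)
  have h0 : 0 <= 2 + x + y - 4 * (x * y) by nra.
  have h1 : 0 <= 9 / 4 + (x + y) / 2 - 3 * (x * y) by nra.
  have : 0 <= e * ((1 - 4 * e) * (2 + x + y - 4 * (x * y)) +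
      4 * e * (9 / 4 + (x + y) / 2 - 3 * (x * y))).
    rewrite mulr_ge0 ?(ltW e0)// addr_ge0// mulr_ge0//; lra.
  lra.
- move=> m /[dup] m01 /andP[m0 m1]; rewrite Gamma_bncdf// -/kap.
  have trm : 0 < tr m < 1 by rewrite tr01// !ltW.
  apply: le_trans (bncdf_diag_lip rho0 kap0 kap2 m01 trm) _.
  rewrite lerD2l ler_wpM2l// /tr ler_norml; apply/andP; split; nra.
Qed.

End BellmanFunction.

(** * Averaging over coordinates of a product space *)

Section BigDffun.
Variables (R : comNzRingType) (I : finType) (T : I -> finType).

Lemma sum_prod_dffun (g : forall i, T i -> R) :
  \sum_(w : {dffun forall i, T i}) \prod_i g i (w i) = \prod_i \sum_x g i x.
Proof.
pose P i : {ffun T i -> R} := [ffun x => g i x].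
rewrite (reindex (@dffun_of_fprod I T)); last first.
  by apply: onW_bij; exact: dffun_of_fprod_bij.
under eq_bigr do under eq_bigr do rewrite ffunE.
transitivity (\sum_(t : fprod T) \prod_i P i (t i)).
  by apply: eq_bigr => t _; apply: eq_bigr => i _; rewrite ffunE.
rewrite (@big_fprod _ 0 1 *%R +%R I T P).
transitivity (\prod_i \sum_x P i x).
  rewrite -(bigA_distr_big_dep _ (fun i => untag 0 (P i))).
  by apply: eq_bigr => i _; rewrite (@big_tag _ _ _ _ _ P i).
by apply: eq_bigr => i _; apply: eq_bigr => x _; rewrite ffunE.
Qed.

End BigDffun.

Section Resampling.
Variables (R : realType) (n : nat) (Omega : 'I_n -> finType).
Variable mu : forall i, Omega i -> R.
Arguments mu : clear implicits.
Hypothesis mu_prob : forall i, is_fin_prob (mu i).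
Notation prod_space := (prod_space Omega).
Notation expect := (expect mu).

Definition subst (k : 'I_n) (x : Omega k) (w : prod_space) : prod_space :=
  [ffun j => @eqtype.dfwith _ Omega (fun i => w i) k x j].

Lemma subst_in k (x : Omega k) w : subst x w k = x.
Proof. by rewrite ffunE dfwith_in. Qed.

Lemma subst_out k j (x : Omega k) w : k != j -> subst x w j = w j.
Proof. by move=> kj; rewrite ffunE dfwith_out. Qed.

Lemma subst_id k (w : prod_space) : subst (w k) w = w.
Proof.
apply/ffunP => j; have [<-|kj] := eqVneq k j; first by rewrite subst_in.
by rewrite subst_out.
Qed.

Lemma substK k (x y : Omega k) w : subst y (subst x w) = subst y w.
Proof.
apply/ffunP => j; have [<-|kj] := eqVneq k j; first by rewrite !subst_in.
by rewrite !subst_out.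
Qed.

Lemma substC k j (x : Omega k) (y : Omega j) w : k != j ->
  subst x (subst y w) = subst y (subst x w).
Proof.
move=> kj; apply/ffunP => i; have [ki|ki] := eqVneq k i.
  by case: _ / ki kj => kj; rewrite subst_in subst_out ?subst_in// eq_sym.
rewrite subst_out//; have [ji|ji] := eqVneq j i.
  by case: _ / ji ki => ki; rewrite !subst_in.
by rewrite !subst_out.
Qed.

Lemma mu_ge0 i x : 0 <= mu i x. Proof. exact: (mu_prob i).1. Qed.

Lemma mu_sum i : \sum_x mu i x = 1. Proof. exact: (mu_prob i).2. Qed.

Lemma prod_weight_ge0 w : 0 <= prod_weight mu w.
Proof. by apply: prodr_ge0 => i _; exact: mu_ge0. Qed.

Lemma prod_substE k (g : forall i, Omega i -> R) (x : Omega k) w :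
  (\prod_i g i (subst x w i)) * g k (w k) = (\prod_i g i (w i)) * g k x.
Proof.
rewrite (bigD1 k)//= [in RHS](bigD1 k)//= subst_in.
rewrite (eq_bigr (fun i => g i (w i))); first by ring.
by move=> i ik; rewrite subst_out// eq_sym.
Qed.

(** Swapping coordinate [k] with an independent sample of [mu k] is an involution of
    [prod_space * Omega k] that preserves the product weight. *)
Lemma expect_subst k F :
  expect F = expect (fun w => \sum_x mu k x * F (subst x w)).
Proof.
transitivity (\sum_(p : prod_space * Omega k)
    prod_weight mu p.1 * mu k p.2 * F p.1).
  rewrite /expect -(pair_bigA _ (fun w x => prod_weight mu w * mu k x * F w))/=.
  apply: eq_bigr => w _; rewrite -mulr_suml -mulr_sumr mu_sum mulr1//.
have inv : involutive (fun p : prod_space * Omega k => (subst p.2 p.1, p.1 k)).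
  by case=> w x; rewrite /= substK subst_id subst_in.
rewrite (reindex_inj (inv_inj inv))/= /expect.
rewrite -(pair_bigA _ (fun w x =>
  prod_weight mu (subst x w) * mu k (w k) * F (subst x w)))/=.
apply: eq_bigr => w _; rewrite mulr_sumr; apply: eq_bigr => x _.
by rewrite mulrA; congr (_ * _); exact: prod_substE.
Qed.

Lemma expectD F G : expect (fun w => F w + G w) = expect F + expect G.
Proof. by rewrite -big_split/=; apply: eq_bigr => w _; rewrite mulrDr. Qed.

Lemma expectZ (a : R) F : expect (fun w => a * F w) = a * expect F.
Proof. by rewrite mulr_sumr; apply: eq_bigr => w _; rewrite mulrCA. Qed.

Lemma expect_le F G : (forall w, F w <= G w) -> expect F <= expect G.
Proof. by move=> FG; apply: ler_sum => w _; rewrite ler_wpM2l ?prod_weight_ge0. Qed.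

Lemma expect_ge0 F : (forall w, 0 <= F w) -> 0 <= expect F.
Proof. by move=> F0; apply: sumr_ge0 => w _; rewrite mulr_ge0 ?prod_weight_ge0. Qed.

Lemma eq_expect F G : F =1 G -> expect F = expect G.
Proof. by move=> FG; apply: eq_bigr => w _; rewrite FG. Qed.

Lemma expect_sum (J : finType) (F : J -> prod_space -> R) :
  expect (fun w => \sum_j F j w) = \sum_j expect (F j).
Proof.
by rewrite /expect exchange_big; apply: eq_bigr => w _; rewrite mulr_sumr.
Qed.

Lemma expect_prod (g : forall i, Omega i -> R) :
  expect (fun w => \prod_i g i (w i)) = \prod_i \sum_x mu i x * g i x.
Proof.
rewrite -(@sum_prod_dffun _ _ Omega (fun i x => mu i x * g i x)).
by apply: eq_bigr => w _; rewrite -big_split.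
Qed.

Lemma prod_weight_sum : \sum_w prod_weight mu w = 1.
Proof.
by rewrite (@sum_prod_dffun _ _ Omega mu) big1// => i _; exact: mu_sum.
Qed.

Lemma expect_cst (a : R) : expect (fun=> a) = a.
Proof. by rewrite /expect -mulr_suml prod_weight_sum mul1r. Qed.

Definition avg (k : 'I_n) (f : prod_space -> R) (w : prod_space) : R :=
  \sum_x mu k x * f (subst x w).

Lemma expect_avg k f : expect (avg k f) = expect f.
Proof. by rewrite [RHS](expect_subst k). Qed.

Lemma avg_subst k f (x : Omega k) w : avg k f (subst x w) = avg k f w.
Proof. by apply: eq_bigr => y _; rewrite substK. Qed.

Lemma avg_le k f g : (forall w, f w <= g w) -> forall w, avg k f w <= avg k g w.
Proof. by move=> fg w; apply: ler_sum => x _; rewrite ler_wpM2l ?mu_ge0. Qed.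

Lemma avg_cst k (a : R) w : avg k (fun=> a) w = a.
Proof. by rewrite /avg -mulr_suml mu_sum mul1r. Qed.

Lemma avg_itv k f : (forall w, 0 <= f w <= 1) -> forall w, 0 <= avg k f w <= 1.
Proof.
move=> f01 w; apply/andP; split.
  by rewrite -(avg_cst k 0 w); apply: avg_le => v; have /andP[] := f01 v.
by rewrite -[leRHS](avg_cst k 1 w); apply: avg_le => v; have /andP[] := f01 v.
Qed.

Variable rho : R.
Hypothesis rho01 : 0 <= rho <= 1.

Definition nker i (y z : Omega i) : R := rho * (z == y)%:R + (1 - rho) * mu i z.

Lemma nker_ge0 i y z : 0 <= @nker i y z.
Proof.
case/andP: rho01 => r0 r1.
by rewrite addr_ge0// mulr_ge0 ?mu_ge0// ?subr_ge0.
Qed.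

Lemma sum_nker i y (F : Omega i -> R) :
  \sum_z nker y z * F z = rho * F y + (1 - rho) * \sum_z mu i z * F z.
Proof.
under eq_bigr do rewrite mulrDl -!mulrA.
rewrite big_split/= -!mulr_sumr; congr (_ * _ + _).
rewrite (bigD1 y)//= eqxx mul1r big1 ?addr0// => z /negPf ->.
by rewrite mul0r.
Qed.

Lemma sum_nker_l i (z : Omega i) : \sum_y mu i y * nker y z = mu i z.
Proof.
under eq_bigr do rewrite mulrDr.
rewrite big_split/= -mulr_suml mu_sum mul1r.
rewrite (bigD1 z)//= eqxx mulr1 big1 => [|y /negPf yz].
  by rewrite addr0 mulrC -mulrDl addrC subrK mul1r.
by rewrite eq_sym yz !mulr0.
Qed.

Definition pair_expect (F : prod_space -> prod_space -> R) : R :=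
  \sum_w \sum_w' prod_weight mu w * noise_kernel mu rho w w' * F w w'.

Lemma pair_weight_ge0 w w' : 0 <= prod_weight mu w * noise_kernel mu rho w w'.
Proof.
rewrite mulr_ge0 ?prod_weight_ge0//; apply: prodr_ge0 => i _.
exact: nker_ge0.
Qed.

Lemma pair_expect_le F G : (forall w w', F w w' <= G w w') ->
  pair_expect F <= pair_expect G.
Proof.
move=> FG; apply: ler_sum => w _; apply: ler_sum => w' _.
by rewrite ler_wpM2l ?pair_weight_ge0.
Qed.

Lemma pair_expectD F G : pair_expect (fun w w' => F w w' + G w w') =
  pair_expect F + pair_expect G.
Proof.
rewrite -big_split/=; apply: eq_bigr => w _; rewrite -big_split/=.
by apply: eq_bigr => w' _; rewrite mulrDr.
Qed.

Lemma pair_expectZ (a : R) F : pair_expect (fun w w' => a * F w w') =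
  a * pair_expect F.
Proof.
rewrite mulr_sumr; apply: eq_bigr => w _; rewrite mulr_sumr.
by apply: eq_bigr => w' _; rewrite mulrCA.
Qed.

Lemma noise_kernel_sum w : \sum_w' noise_kernel mu rho w w' = 1.
Proof.
rewrite (@sum_prod_dffun _ _ Omega (fun i => nker (w i))) big1// => i _.
rewrite -(eq_bigr _ (fun z _ => mulr1 (nker (w i) z))) sum_nker.
under eq_bigr do rewrite mulr1.
by rewrite mu_sum !mulr1 addrC subrK.
Qed.

Lemma pair_expect_fst F : pair_expect (fun w _ => F w) = expect F.
Proof.
apply: eq_bigr => w _; rewrite -mulr_suml -mulr_sumr noise_kernel_sum.
by rewrite mulr1.
Qed.

Lemma pair_expect_snd F : pair_expect (fun _ w' => F w') = expect F.
Proof.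
rewrite /pair_expect exchange_big/=; apply: eq_bigr => w' _.
rewrite -mulr_suml; congr (_ * _).
under eq_bigr do rewrite -big_split/=.
rewrite (@sum_prod_dffun _ _ Omega (fun i y => mu i y * nker y (w' i))).
by apply: eq_bigr => i _; exact: sum_nker_l.
Qed.

(** The same swap for pairs: the law of the correlated pair is a product over coordinates, so its
    [k]-th factor can be exchanged with a fresh correlated pair [(y, z)]. *)
Lemma pair_expect_subst k F : pair_expect F =
  pair_expect (fun w w' => \sum_y \sum_z mu k y * nker y z *
    F (subst y w) (subst z w')).
Proof.
pose T := (prod_space * prod_space * (Omega k * Omega k))%type.
pose W w w' := prod_weight mu w * noise_kernel mu rho w w'.
pose m (y z : Omega k) := mu k y * nker y z.
have mE w w' : W w w' = \prod_i (mu i (w i) * nker (w i) (w' i)).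
  by rewrite /W /prod_weight /noise_kernel -big_split.
transitivity (\sum_(p : T) W p.1.1 p.1.2 * m p.2.1 p.2.2 * F p.1.1 p.1.2).
  rewrite -(pair_bigA _ (fun p q => W p.1 p.2 * m q.1 q.2 * F p.1 p.2))/=.
  rewrite -(pair_bigA _ (fun w w' => \sum_q W w w' * m q.1 q.2 * F w w'))/=.
  apply: eq_bigr => w _; apply: eq_bigr => w' _.
  rewrite -mulr_suml -mulr_sumr -(pair_bigA _ (fun y z => m y z))/=.
  rewrite [X in W _ _ * X](_ : _ = 1) ?mulr1//.
  rewrite exchange_big/= -[RHS](mu_sum k).
  by apply: eq_bigr => z _; exact: sum_nker_l.
have inv : involutive (fun p : T => ((subst p.2.1 p.1.1, subst p.2.2 p.1.2),
    (p.1.1 k, p.1.2 k))).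
  by case=> [[w w'] [y z]]; rewrite /= !substK !subst_id !subst_in.
rewrite (reindex_inj (inv_inj inv))/=.
rewrite -(pair_bigA _ (fun p q => W (subst q.1 p.1) (subst q.2 p.2) *
  m (p.1 k) (p.2 k) * F (subst q.1 p.1) (subst q.2 p.2)))/=.
rewrite -(pair_bigA _ (fun w w' => \sum_q W (subst q.1 w) (subst q.2 w') *
  m (w k) (w' k) * F (subst q.1 w) (subst q.2 w')))/=.
apply: eq_bigr => w _; apply: eq_bigr => w' _.
rewrite -/(W w w') -(pair_bigA _ (fun y z => W (subst y w) (subst z w') *
  m (w k) (w' k) * F (subst y w) (subst z w')))/=.
rewrite mulr_sumr; apply: eq_bigr => y _; rewrite mulr_sumr.
apply: eq_bigr => z _; rewrite mulrA; congr (_ * _).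
rewrite !mE (bigD1 k)//= [in RHS](bigD1 k)//= !subst_in -/(m y z) -/(m _ _).
rewrite (eq_bigr (fun i => mu i (w i) * nker (w i) (w' i))); first by ring.
by move=> i ik; rewrite !subst_out// eq_sym.
Qed.

End Resampling.

(** * The induction step: one coordinate resampled *)

Section Tensorization.
Variables (R : realType) (n : nat) (Omega : 'I_n -> finType).
Variable mu : forall i, Omega i -> R.
Arguments mu : clear implicits.
Hypothesis mu_prob : forall i, is_fin_prob (mu i).
Variables (rho M : R) (Psi : R -> R -> R).
Hypotheses (rho01 : 0 <= rho <= 1) (M0 : 0 <= M) (PsiM : step_bound Psi rho M).
Notation expect := (expect mu).
Notation avg := (avg mu).
Notation pair_expect := (pair_expect mu rho).

Definition cube_increment k (h : prod_space Omega -> R) : R :=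
  expect (fun w => `|h w - avg k h w| ^+ 3).

(* Resampling the k-th coordinates of w and w': the increments u and v have mean
   zero and E[u v] = rho * sum_y mu_k(y) u(y) v(y), so that the second-order
   term averages the nonpositive quadratic form at (u(y), v(y)). *)
Lemma pair_expect_step k (h : prod_space Omega -> R) :
  (forall w, 0 <= h w <= 1) ->
  pair_expect (fun w w' => Psi (h w) (h w')) <=
  pair_expect (fun w w' => Psi (avg k h w) (avg k h w')) +
  2 * M * cube_increment k h.
Proof.
move=> h01; pose G w := avg k (fun v => `|h v - avg k h v| ^+ 3) w.
have EG : expect G = cube_increment k h by exact: expect_avg.
suff H w w' : \sum_y \sum_z mu k y * nker mu rho y z *
    Psi (h (subst y w)) (h (subst z w')) <=
    Psi (avg k h w) (avg k h w') + M * (G w + G w').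
  rewrite (pair_expect_subst mu_prob rho k).
  apply: le_trans (pair_expect_le mu_prob rho01 H) _.
  rewrite pair_expectD lerD2l pair_expectZ pair_expectD.
  rewrite (pair_expect_fst mu_prob) (pair_expect_snd mu_prob) EG.
  by rewrite -mulrA mulrCA -mulr2n [2 * _]mulr_natl.
set a := avg k h w; set b := avg k h w'.
have ha01 := avg_itv mu_prob k h01 w; have hb01 := avg_itv mu_prob k h01 w'.
have [P [Q [F11 [F12 [F22 [F0 FB]]]]]] := PsiM ha01 hb01.
pose u (y : Omega k) : R := h (subst y w) - a.
pose v (z : Omega k) : R := h (subst z w') - b.
pose m y z := mu k y * nker mu rho y z.
have m0 y z : 0 <= m y z by rewrite mulr_ge0 ?mu_ge0 ?nker_ge0.
have muu : \sum_y mu k y * u y = 0.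
  under eq_bigr do rewrite mulrBr.
  by rewrite sumrB -mulr_suml (mu_sum mu_prob) mul1r subrr.
have muv : \sum_y mu k y * v y = 0.
  under eq_bigr do rewrite mulrBr.
  by rewrite sumrB -mulr_suml (mu_sum mu_prob) mul1r subrr.
have mfst (F : Omega k -> R) : \sum_y \sum_z m y z * F y = \sum_y mu k y * F y.
  apply: eq_bigr => y _; rewrite -mulr_suml -mulr_sumr.
  rewrite -(eq_bigr _ (fun z _ => mulr1 (nker mu rho y z))) sum_nker.
  under eq_bigr do rewrite mulr1.
  by rewrite (mu_sum mu_prob) !mulr1 addrC subrK mulr1.
have msnd (F : Omega k -> R) : \sum_y \sum_z m y z * F z = \sum_z mu k z * F z.
  rewrite exchange_big/=; apply: eq_bigr => z _.
  by rewrite -mulr_suml (sum_nker_l mu_prob).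
have muv2 : \sum_y \sum_z m y z * (u y * v z) = rho * \sum_y mu k y * (u y * v y).
  rewrite mulr_sumr; apply: eq_bigr => y _.
  transitivity (mu k y * u y * \sum_z nker mu rho y z * v z).
    by rewrite mulr_sumr; apply: eq_bigr => z _; rewrite /m; ring.
  by rewrite sum_nker muv; ring.
apply: (@le_trans _ _ (\sum_y \sum_z m y z * (Psi a b + P * u y + Q * v z +
    (F11 * u y ^+ 2 + 2 * F12 * (u y * v z) + F22 * v z ^+ 2) / 2 +
    M * (`|u y| ^+ 3 + `|v z| ^+ 3)))).
  apply: ler_sum => y _; apply: ler_sum => z _.
  apply: (ler_wpM2l (m0 y z)).
  have ua : a + u y = h (subst y w) by rewrite /u subrKC.
  have vb : b + v z = h (subst z w') by rewrite /v subrKC.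
  have := FB (u y) (v z); rewrite -/a -/b ua vb.
  by apply; exact: h01.
have Gw : G w = \sum_y mu k y * `|u y| ^+ 3.
  by apply: eq_bigr => y _; rewrite avg_subst.
have Gw' : G w' = \sum_y mu k y * `|v y| ^+ 3.
  by apply: eq_bigr => y _; rewrite avg_subst.
have -> : \sum_y \sum_z m y z * (Psi a b + P * u y + Q * v z +
    (F11 * u y ^+ 2 + 2 * F12 * (u y * v z) + F22 * v z ^+ 2) / 2 +
    M * (`|u y| ^+ 3 + `|v z| ^+ 3)) =
  \sum_y \sum_z m y z * (Psi a b + P * u y + F11 / 2 * u y ^+ 2 + M * `|u y| ^+ 3)
  + \sum_y \sum_z m y z * (Q * v z + F22 / 2 * v z ^+ 2 + M * `|v z| ^+ 3)
  + F12 * \sum_y \sum_z m y z * (u y * v z).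
  rewrite mulr_sumr -!big_split/=; apply: eq_bigr => y _.
  rewrite mulr_sumr -!big_split/=; apply: eq_bigr => z _.
  by field.
rewrite (mfst (fun y => Psi a b + P * u y + F11 / 2 * u y ^+ 2 + M * `|u y| ^+ 3)).
rewrite (msnd (fun z => Q * v z + F22 / 2 * v z ^+ 2 + M * `|v z| ^+ 3)) muv2.
have quad : \sum_y mu k y * (F11 * u y ^+ 2 + 2 * rho * F12 * (u y * v y)
    + F22 * v y ^+ 2) <= 0.
  by apply: sumr_le0 => y _; rewrite mulr_ge0_le0 ?mu_ge0.
have -> : \sum_y mu k y * (Psi a b + P * u y + F11 / 2 * u y ^+ 2 + M * `|u y| ^+ 3)
  + \sum_z mu k z * (Q * v z + F22 / 2 * v z ^+ 2 + M * `|v z| ^+ 3) +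
  F12 * (rho * \sum_y mu k y * (u y * v y)) =
  Psi a b * (\sum_y mu k y) + P * (\sum_y mu k y * u y) + Q * (\sum_y mu k y * v y) +
  M * (G w + G w') + (\sum_y mu k y * (F11 * u y ^+ 2 +
    2 * rho * F12 * (u y * v y) + F22 * v y ^+ 2)) / 2.
  rewrite Gw Gw' -big_split/= !mulr_sumr mulr_suml -!big_split/=.
  rewrite mulr_sumr -!big_split/=; apply: eq_bigr => y _; by field.
rewrite muu muv (mu_sum mu_prob) !mulr0 mulr1 !addr0 gerDl.
by rewrite pmulr_lle0.
Qed.

End Tensorization.

(** * Orthonormal expansions *)

Section Fourier.
Variables (R : realType) (n : nat) (Omega : 'I_n -> finType).
Variable mu : forall i, Omega i -> R.
Arguments mu : clear implicits.
Hypothesis mu_prob : forall i, is_fin_prob (mu i).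
Variable X : forall i, 'I_#|Omega i| -> Omega i -> R.
Arguments X : clear implicits.
Hypothesis X_basis : forall i, is_orthonormal_basis (mu i) (X i).
Notation expect := (expect mu).
Notation multi_index := (multi_index Omega).
Implicit Types (a b : multi_index -> R) (s t : multi_index).

Definition basis_fun s (w : prod_space Omega) : R := \prod_i X i (s i) (w i).

Definition fexp a (w : prod_space Omega) : R := \sum_s a s * basis_fun s w.

Lemma X_orth i j l : \sum_x mu i x * (X i j x * X i l x) = (j == l)%:R.
Proof. exact: (X_basis i).1. Qed.

Lemma X_zero i j x : val j = 0%N -> X i j x = 1.
Proof. by move=> j0; exact: (X_basis i).2. Qed.

Lemma X_mean i j : \sum_x mu i x * X i j x = (val j == 0)%:R.
Proof.
have c0 : (0 < #|Omega i|)%N by apply: leq_ltn_trans (ltn_ord j).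
rewrite -[RHS](X_orth j (Ordinal c0)).
by apply: eq_bigr => x _; rewrite [X i (Ordinal _) x]X_zero// mulr1.
Qed.

Lemma basis_fun_orth s t :
  expect (fun w => basis_fun s w * basis_fun t w) = (s == t)%:R.
Proof.
transitivity (expect (fun w => \prod_i (X i (s i) (w i) * X i (t i) (w i)))).
  by apply: eq_expect => w; rewrite -big_split.
rewrite (expect_prod mu (fun i x => X i (s i) x * X i (t i) x)).
under eq_bigr do rewrite X_orth.
have [->|/eqP st] := eqVneq s t; first by rewrite big1// => i _; rewrite eqxx.
have /existsP[i si] : [exists i, s i != t i].
  case: (boolP [exists i, s i != t i]) => // /existsPn h; case: st.
  by apply/ffunP => i; apply/eqP; move: (h i); rewrite negbK.
by rewrite (bigD1 i)//= (negPf si) mul0r.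
Qed.

Lemma expect_fexpM a b :
  expect (fun w => fexp a w * fexp b w) = \sum_s a s * b s.
Proof.
transitivity (expect (fun w => \sum_s \sum_t
    (a s * b t) * (basis_fun s w * basis_fun t w))).
  apply: eq_expect => w; rewrite mulr_suml; apply: eq_bigr => s _.
  by rewrite mulr_sumr; apply: eq_bigr => t _; ring.
rewrite expect_sum; apply: eq_bigr => s _; rewrite expect_sum.
rewrite (bigD1 s)//= expectZ basis_fun_orth eqxx mulr1 big1 ?addr0// => t ts.
by rewrite expectZ basis_fun_orth eq_sym (negPf ts) mulr0.
Qed.

Definition null_index s := [forall i, val (s i) == 0%N].

Lemma basis_fun_null s w : null_index s -> basis_fun s w = 1.
Proof.
by move=> /forallP s0; rewrite /basis_fun big1// => i _; rewrite X_zero//; apply/eqP.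
Qed.

Lemma expect_fexp a : expect (fexp a) = \sum_s a s * (null_index s)%:R.
Proof.
rewrite expect_sum; apply: eq_bigr => s _; rewrite expectZ; congr (_ * _).
rewrite (expect_prod mu (fun i x => X i (s i) x)).
under eq_bigr do rewrite X_mean.
have [/forallP s0|/forallPn[i si]] := boolP (null_index s).
  by rewrite big1// => i _; rewrite s0.
by rewrite (bigD1 i)//= (negPf si) mul0r.
Qed.

Lemma avg_basis_fun k s w :
  avg mu k (basis_fun s) w = (val (s k) == 0)%:R * basis_fun s w.
Proof.
pose rest := \prod_(i | i != k) X i (s i) (w i).
have subE x : basis_fun s (subst x w) = X k (s k) x * rest.
  rewrite /basis_fun (bigD1 k)//= subst_in; congr (_ * _).
  by apply: eq_bigr => i ik; rewrite subst_out// eq_sym.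
rewrite /avg; under eq_bigr do rewrite subE mulrA.
rewrite -mulr_suml X_mean; have [s0|s0] := eqVneq (val (s k)) 0%N.
  by rewrite !mul1r /basis_fun (bigD1 k)//= X_zero// mul1r.
by rewrite !mul0r.
Qed.

Lemma avg_fexp k a w :
  avg mu k (fexp a) w = fexp (fun s => a s * (val (s k) == 0)%:R) w.
Proof.
rewrite /avg; under eq_bigr do rewrite mulr_sumr.
rewrite exchange_big; apply: eq_bigr => s _.
rewrite -mulrA -avg_basis_fun mulr_sumr.
by apply: eq_bigr => x _; rewrite mulrCA.
Qed.

Lemma noise_op_fexp rho a w :
  noise_op mu rho (fexp a) w = fexp (fun s => a s * rho ^+ weight s) w.
Proof.
rewrite /noise_op; under eq_bigr do rewrite mulr_sumr.
rewrite exchange_big; apply: eq_bigr => s _ /=.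
rewrite -mulrA; under eq_bigr do rewrite mulrCA.
rewrite -mulr_sumr; congr (_ * _).
transitivity (\sum_(w' : prod_space Omega)
    \prod_i (nker mu rho (w i) (w' i) * X i (s i) (w' i))).
  by apply: eq_bigr => w' _; rewrite /noise_kernel /basis_fun -big_split.
rewrite (@sum_prod_dffun _ _ Omega (fun i z => nker mu rho (w i) z * X i (s i) z)).
rewrite /weight -prodr_const /basis_fun [in RHS]big_mkcond -big_split/=.
apply: eq_bigr => i _; rewrite sum_nker X_mean inE lt0n.
have [s0|s0] := eqVneq (val (s i)) 0%N.
  by rewrite X_zero//=; ring.
by rewrite /=; ring.
Qed.

Lemma noise_stability_fexp rho a :
  noise_stability mu rho (fexp a) = \sum_s a s ^+ 2 * rho ^+ weight s.
Proof.
rewrite /noise_stability.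
transitivity (expect (fun w => fexp a w * fexp (fun s => a s * rho ^+ weight s) w)).
  by apply: eq_expect => w; rewrite noise_op_fexp.
by rewrite expect_fexpM; apply: eq_bigr => s _; rewrite mulrA expr2.
Qed.

End Fourier.

(** * Hypercontractivity *)

Section OneCoordinate.
Variables (R : realType) (T : finType) (m : T -> R) (alpha beta : R).
Hypotheses (m_prob : is_fin_prob m) (alpha0 : 0 < alpha) (alpha1 : alpha <= 1)
  (m_alpha : forall x, alpha <= m x) (beta2 : beta ^+ 2 = alpha / 4).

(** Write [f = c + g] with [g] of mean zero and variance [V]; the left side is the fourth moment of
    [c + beta g]. AM-GM absorbs the cubic term into its neighbours, and [alpha g(x)^2 <= V] at each
    atom bounds the fourth moment of [g] by [V^2 / alpha]. With [beta^2 = alpha / 4] the total is at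
    most [(c^2 + V)^2]. *)
Lemma hypercontractive_coordinate (f : T -> R) :
  \sum_x m x * (beta * f x + (1 - beta) * \sum_y m y * f y) ^+ 4 <=
  (\sum_x m x * f x ^+ 2) ^+ 2.
Proof.
have [c cE] : exists c, c = \sum_y m y * f y by eexists.
rewrite -cE; pose g x := f x - c.
have [m0 m1] := m_prob.
pose V := \sum_x m x * g x ^+ 2; pose F := \sum_x m x * g x ^+ 4.
have mg : \sum_x m x * g x = 0.
  under eq_bigr do rewrite mulrBr.
  by rewrite sumrB -mulr_suml m1 mul1r -cE subrr.
have V0 : 0 <= V by apply: sumr_ge0 => x _; rewrite mulr_ge0 ?sqr_ge0.
have fE : \sum_x m x * f x ^+ 2 = c ^+ 2 + V.
  transitivity (c ^+ 2 * (\sum_x m x) + 2 * c * (\sum_x m x * g x) + V).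
    rewrite /V !mulr_sumr -!big_split/=; apply: eq_bigr => x _.
    by rewrite /g; ring.
  by rewrite m1 mg mulr0 mulr1 addr0.
have FV : alpha * F <= V ^+ 2.
  rewrite mulr_sumr expr2 {1}/V mulr_suml; apply: ler_sum => x _.
  have mgV : m x * g x ^+ 2 <= V.
    rewrite /V (bigD1 x)//= lerDl; apply: sumr_ge0 => y _.
    by rewrite mulr_ge0 ?sqr_ge0.
  have agV : alpha * g x ^+ 2 <= V.
    by apply: le_trans mgV; rewrite ler_wpM2r ?sqr_ge0.
  rewrite (_ : alpha * (m x * _) = (m x * g x ^+ 2) * (alpha * g x ^+ 2)); last by ring.
  by rewrite ler_wpM2l// mulr_ge0 ?sqr_ge0.
rewrite fE.
apply: (@le_trans _ _ (\sum_x m x * (c ^+ 4 + 4 * c ^+ 3 * beta * g x +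
    8 * (c ^+ 2 * beta ^+ 2) * g x ^+ 2 + 3 * beta ^+ 4 * g x ^+ 4))).
  apply: ler_sum => x _; rewrite ler_wpM2l//.
  have -> : beta * f x + (1 - beta) * c = c + beta * g x by rewrite /g; ring.
  have : 0 <= 2 * (beta * g x) ^+ 2 * (c - beta * g x) ^+ 2.
    by rewrite mulr_ge0 ?sqr_ge0// mulr_ge0 ?sqr_ge0.
  rewrite -subr_ge0 => H; rewrite -subr_ge0; apply: le_trans H _.
  by rewrite le_eqVlt; apply/orP; left; apply/eqP; ring.
have -> : \sum_x m x * (c ^+ 4 + 4 * c ^+ 3 * beta * g x +
    8 * (c ^+ 2 * beta ^+ 2) * g x ^+ 2 + 3 * beta ^+ 4 * g x ^+ 4) =
  c ^+ 4 * (\sum_x m x) + 4 * c ^+ 3 * beta * (\sum_x m x * g x) +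
  8 * (c ^+ 2 * beta ^+ 2) * V + 3 * beta ^+ 4 * F.
  rewrite /V /F !mulr_sumr -!big_split/=; apply: eq_bigr => x _; ring.
rewrite m1 mg mulr0 addr0 mulr1.
have -> : beta ^+ 4 = (alpha / 4) ^+ 2 by rewrite -beta2 -exprM.
rewrite beta2.
have F3 : 3 * (alpha / 4) ^+ 2 * F <= V ^+ 2.
  rewrite (_ : _ * F = (3 / 16 * alpha) * (alpha * F)); last by field.
  have aF0 : 0 <= alpha * F.
    rewrite mulr_ge0 ?(ltW alpha0)//; apply: sumr_ge0 => x _.
    by rewrite mulr_ge0// exprn_even_ge0.
  by apply: le_trans FV; apply: ler_piMl => //; have := alpha1; lra.
have c2V : 8 * (c ^+ 2 * (alpha / 4)) * V <= 2 * c ^+ 2 * V.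
  apply: (ler_wpM2r V0); rewrite -subr_ge0.
  rewrite (_ : _ - _ = 2 * c ^+ 2 * (1 - alpha)); last by field.
  by rewrite mulr_ge0 ?subr_ge0// mulr_ge0 ?sqr_ge0.
have -> : (c ^+ 2 + V) ^+ 2 = c ^+ 4 + 2 * c ^+ 2 * V + V ^+ 2 by ring.
by rewrite lerD// lerD.
Qed.

End OneCoordinate.

Section Hypercontractivity.
Variables (R : realType) (n : nat) (Omega : 'I_n -> finType).
Variable mu : forall i, Omega i -> R.
Arguments mu : clear implicits.
Hypothesis mu_prob : forall i, is_fin_prob (mu i).
Variables (alpha beta : R).
Hypotheses (alpha0 : 0 < alpha) (alpha1 : alpha <= 1)
  (mu_alpha : forall i x, alpha <= mu i x) (beta2 : beta ^+ 2 = alpha / 4).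
Notation expect := (expect mu).
Notation avg := (avg mu).
Implicit Types (u v : prod_space Omega -> R).

(** Lagrange's identity: twice the gap is the mean of [(u w * v w' - u w' * v w)^2] over independent
    [w] and [w']. *)
Lemma expect_cauchy u v :
  expect (fun w => u w * v w) ^+ 2 <=
  expect (fun w => u w ^+ 2) * expect (fun w => v w ^+ 2).
Proof.
pose W := @prod_weight _ _ Omega mu.
have : 0 <= \sum_w \sum_w' W w * W w' * (u w * v w' - u w' * v w) ^+ 2.
  apply: sumr_ge0 => w _; apply: sumr_ge0 => w' _.
  by rewrite mulr_ge0 ?sqr_ge0// mulr_ge0 ?prod_weight_ge0.
pose Eu := expect (fun w => u w ^+ 2); pose Ev := expect (fun w => v w ^+ 2).
pose Euv := expect (fun w => u w * v w).
have E2 F G : expect F * expect G = \sum_w \sum_w' W w * W w' * (F w * G w').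
  rewrite /expect mulr_suml; apply: eq_bigr => w _; rewrite mulr_sumr.
  by apply: eq_bigr => w' _; rewrite -/(W w) -/(W w'); ring.
have -> : \sum_w \sum_w' W w * W w' * (u w * v w' - u w' * v w) ^+ 2 =
    Eu * Ev + Ev * Eu - 2 * (Euv * Euv).
  rewrite /Eu /Ev /Euv !E2 -big_split/= mulr_sumr -sumrB; apply: eq_bigr => w _.
  rewrite -big_split/= mulr_sumr -sumrB; apply: eq_bigr => w' _; ring.
by rewrite -/Eu -/Ev -/Euv; lra.
Qed.

Definition noise1 k u w : R := beta * u w + (1 - beta) * avg k u w.

Definition noise_seq (l : seq 'I_n) u := foldr noise1 u l.

Definition depends_on (l : seq 'I_n) u :=
  forall w w' : prod_space Omega, (forall i, i \in l -> w i = w' i) -> u w = u w'.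

Lemma noise_seq_subst l k (x : Omega k) u w : k \notin l ->
  noise_seq l u (subst x w) = noise_seq l (fun w => u (subst x w)) w.
Proof.
elim: l w => [//|j l IH] w; rewrite inE negb_or => /andP[kj kl].
rewrite /= /noise1 IH//; congr (_ + _ * _).
by apply: eq_bigr => y _; rewrite -IH// substC// eq_sym.
Qed.

(* Fixing the k-th coordinate to x in v = T u gives T applied to the restriction
   of u; the inequality on one coordinate and Cauchy-Schwarz for the pairs
   v_x^2, v_y^2 then reduce to the induction hypothesis. *)
Lemma hypercontractive_seq l u : uniq l -> depends_on l u ->
  expect (fun w => noise_seq l u w ^+ 4) <= expect (fun w => u w ^+ 2) ^+ 2.
Proof.
elim: l u => [|k l IH] u.
  move=> _ u0; have uc w w' : u w = u w' by exact: u0.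
  have [w0 _|noW] := pickP (@predT (prod_space Omega)); last first.
    by rewrite /expect !big_pred0// expr0n.
  have -> : expect (fun w => noise_seq [::] u w ^+ 4) = expect (fun=> u w0 ^+ 4).
    by apply: eq_expect => w; rewrite /= (uc w w0).
  have -> : expect (fun w => u w ^+ 2) = expect (fun=> u w0 ^+ 2).
    by apply: eq_expect => w; rewrite (uc w w0).
  by rewrite !expect_cst// -exprM.
move=> /= /andP[kl ul] uk.
pose v := noise_seq l u.
pose ux (x : Omega k) w := u (subst x w).
have vx x w : v (subst x w) = noise_seq l (ux x) w by exact: noise_seq_subst.
have v4 x : expect (fun w => v (subst x w) ^+ 4) <=
    expect (fun w => ux x w ^+ 2) ^+ 2.
  have -> : expect (fun w => v (subst x w) ^+ 4) =
      expect (fun w => noise_seq l (ux x) w ^+ 4).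
    by apply: eq_expect => w; rewrite vx.
  apply: IH => // w w' ww; apply: uk => i; rewrite inE => /orP[/eqP->|il].
    by rewrite !subst_in.
  by rewrite !subst_out ?ww//; apply: contraNneq kl => ->.
rewrite (expect_subst mu_prob k).
apply: (@le_trans _ _ (expect (fun w => (\sum_x mu k x * v (subst x w) ^+ 2) ^+ 2))).
  apply: expect_le => // w.
  have := hypercontractive_coordinate (mu_prob k) alpha0 alpha1
    (mu_alpha (i := k)) beta2 (fun x => v (subst x w)).
  apply: le_trans; rewrite le_eqVlt; apply/orP; left; apply/eqP.
  by apply: eq_bigr => x _; rewrite /noise1 -/v avg_subst.
have -> : expect (fun w => u w ^+ 2) = \sum_x mu k x * expect (fun w => ux x w ^+ 2).
  rewrite (expect_subst mu_prob k) expect_sum.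
  by apply: eq_bigr => x _; rewrite expectZ.
have -> : expect (fun w => (\sum_x mu k x * v (subst x w) ^+ 2) ^+ 2) =
  \sum_x \sum_y mu k x * mu k y *
    expect (fun w => v (subst x w) ^+ 2 * v (subst y w) ^+ 2).
  transitivity (expect (fun w => \sum_x \sum_y mu k x * mu k y *
      (v (subst x w) ^+ 2 * v (subst y w) ^+ 2))).
    apply: eq_expect => w; rewrite expr2 mulr_suml; apply: eq_bigr => x _.
    by rewrite mulr_sumr; apply: eq_bigr => y _; rewrite mulrACA.
  rewrite expect_sum; apply: eq_bigr => x _; rewrite expect_sum.
  by apply: eq_bigr => y _; rewrite expectZ.
rewrite expr2 mulr_suml; apply: ler_sum => x _; rewrite mulr_sumr.
apply: ler_sum => y _; rewrite mulrACA ler_wpM2l ?mulr_ge0 ?mu_ge0//.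
have E0 z : 0 <= expect (fun w => ux z w ^+ 2).
  by apply: expect_ge0 => // w; exact: sqr_ge0.
rewrite -(@ler_pXn2r _ 2) ?nnegrE ?mulr_ge0//; last first.
  by apply: expect_ge0 => // w; rewrite mulr_ge0 ?sqr_ge0.
apply: le_trans (expect_cauchy _ _) _; rewrite exprMn.
have v44 z : expect (fun w => (v (subst z w) ^+ 2) ^+ 2) =
    expect (fun w => v (subst z w) ^+ 4).
  by apply: eq_expect => w; rewrite -exprM.
by rewrite !v44 ler_pM//; apply: expect_ge0 => // w; exact: exprn_even_ge0.
Qed.

End Hypercontractivity.

(** * Third moments of increments *)

Section FourierMoments.
Variables (R : realType) (n : nat) (Omega : 'I_n -> finType).
Variable mu : forall i, Omega i -> R.
Arguments mu : clear implicits.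
Hypothesis mu_prob : forall i, is_fin_prob (mu i).
Variable X : forall i, 'I_#|Omega i| -> Omega i -> R.
Arguments X : clear implicits.
Hypothesis X_basis : forall i, is_orthonormal_basis (mu i) (X i).
Variables (alpha beta : R).
Hypotheses (alpha0 : 0 < alpha) (alpha1 : alpha <= 1)
  (mu_alpha : forall i x, alpha <= mu i x)
  (beta0 : 0 < beta) (beta2 : beta ^+ 2 = alpha / 4).
Notation expect := (expect mu).
Notation fexp := (fexp X).
Implicit Types (a b : multi_index Omega -> R) (s : multi_index Omega).

Lemma eq_fexp a b : a =1 b -> fexp a = fexp b.
Proof. by move=> /funext ->. Qed.

Lemma noise1_fexp k a : noise1 mu beta k (fexp a) =
  fexp (fun s => a s * (if val (s k) == 0%N then 1 else beta)).
Proof.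
apply/funext => w; rewrite /noise1 (avg_fexp X_basis).
rewrite !mulr_sumr -big_split/=; apply: eq_bigr => s _.
by case: ifP => _ /=; ring.
Qed.

Lemma noise_seq_fexp l a : noise_seq mu beta l (fexp a) =
  fexp (fun s => a s * \prod_(k <- l) (if val (s k) == 0%N then 1 else beta)).
Proof.
elim: l => [|k l /= ->].
  by apply: eq_fexp => s; rewrite big_nil mulr1.
rewrite noise1_fexp; apply: eq_fexp => s.
by rewrite big_cons -mulrA [X in _ * X]mulrC.
Qed.

Lemma prod_enum_weight s :
  \prod_(k <- enum 'I_n) (if val (s k) == 0%N then 1 else beta) = beta ^+ weight s.
Proof.
rewrite big_enum/= /weight -prodr_const [RHS]big_mkcond.
by apply: eq_bigr => i _; rewrite inE lt0n; case: eqP.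
Qed.

Lemma fexp_moment4 a :
  expect (fun w => fexp (fun s => a s * beta ^+ weight s) w ^+ 4) <=
  (\sum_s a s ^+ 2) ^+ 2.
Proof.
have := @hypercontractive_seq _ _ _ mu mu_prob alpha beta alpha0 alpha1 mu_alpha
  beta2 (enum 'I_n) (fexp a) (enum_uniq _).
rewrite noise_seq_fexp => /(_ _).
have -> : expect (fun w => fexp a w ^+ 2) = \sum_s a s ^+ 2.
  rewrite -[RHS](expect_fexpM X_basis) .
  by apply: eq_expect => w; rewrite expr2.
rewrite (_ : fexp (fun s => a s * \prod_(_ <- _) _) =
  fexp (fun s => a s * beta ^+ weight s)).
  apply=> w w' ww; congr fexp; apply/ffunP => i; apply: ww.
  by rewrite mem_enum.
by apply: eq_fexp => s; rewrite prod_enum_weight.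
Qed.

(** A function of low degree is the noise operator applied to the function with coefficients
    [a s / beta ^+ weight s]; undoing the noise costs at most [D] in squared norm. *)
Lemma fexp_moment4_low a (D : R) : 0 <= D ->
  (forall s, a s != 0 -> (beta ^+ weight s) ^- 2 <= D) ->
  expect (fun w => fexp a w ^+ 4) <= (D * \sum_s a s ^+ 2) ^+ 2.
Proof.
move=> D0 aD; pose b s := a s / beta ^+ weight s.
have -> : fexp a = fexp (fun s => b s * beta ^+ weight s).
  by apply: eq_fexp => s; rewrite /b divfK// expf_neq0// gt_eqF.
apply: le_trans (fexp_moment4 b) _; rewrite lerXn2r ?nnegrE//.
- by apply: sumr_ge0 => s _; exact: sqr_ge0.
- by rewrite mulr_ge0//; apply: sumr_ge0 => s _; exact: sqr_ge0.
rewrite mulr_sumr; apply: ler_sum => s _; rewrite /b.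
have [->|as0] := eqVneq (a s) 0; first by rewrite mul0r expr0n/= mulr0.
by rewrite expr_div_n mulrC ler_wpM2r ?sqr_ge0// aD.
Qed.

(* If |hi| >= |lo| then |v| <= 2 |hi| and |v|^3 <= |v|^2; otherwise |v| <= 2 |lo|,
   and |lo|^3 is split by AM-GM. *)
Lemma cube_le_split (v lo hi lam : R) : `|v| <= 1 -> v = lo + hi -> 0 < lam ->
  `|v| ^+ 3 <= 4 * hi ^+ 2 + 4 * (lam * lo ^+ 2 + lo ^+ 4 / lam).
Proof.
move=> v1 vE lam0.
have v0 := normr_ge0 v; have l0 := normr_ge0 lo; have h0 := normr_ge0 hi.
have vlh : `|v| <= `|lo| + `|hi| by rewrite vE ler_normD.
have lo3 : 2 * `|lo| ^+ 3 <= lam * lo ^+ 2 + lo ^+ 4 / lam.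
  have H : 0 <= `|lo| ^+ 2 * (lam - `|lo|) ^+ 2 / lam.
    by rewrite mulr_ge0 ?invr_ge0 ?(ltW lam0)// mulr_ge0 ?sqr_ge0.
  rewrite (_ : lo ^+ 4 = (lo ^+ 2) ^+ 2); last by rewrite -exprM.
  rewrite -[lo ^+ 2](real_normK (num_real lo)) -subr_ge0; apply: le_trans H _.
  rewrite le_eqVlt; apply/orP; left; apply/eqP.
  by field; rewrite gt_eqF.
have hi2 : 0 <= 4 * hi ^+ 2 by rewrite mulr_ge0 ?sqr_ge0.
have lo0 : 0 <= lam * lo ^+ 2 + lo ^+ 4 / lam.
  apply: addr_ge0; first by rewrite mulr_ge0 ?sqr_ge0 ?(ltW lam0).
  by rewrite divr_ge0 ?exprn_even_ge0 ?(ltW lam0).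
have [lh|hl] := lerP `|lo| `|hi|.
  apply: (@le_trans _ _ (4 * hi ^+ 2)); last by rewrite lerDl mulr_ge0.
  rewrite -[hi ^+ 2](real_normK (num_real hi)).
  have v2 : `|v| <= 2 * `|hi| by lra.
  apply: (@le_trans _ _ (`|v| ^+ 2)); first by rewrite exprS ler_piMl ?exprn_ge0.
  by rewrite (_ : 4 * _ = (2 * `|hi|) ^+ 2); [rewrite lerXn2r ?nnegrE ?mulr_ge0|ring].
apply: (@le_trans _ _ (4 * (2 * `|lo| ^+ 3))); last first.
  by apply: ler_wpDl => //; rewrite ler_pM2l.
rewrite (_ : 4 * _ = (2 * `|lo|) ^+ 3); last by ring.
by rewrite lerXn2r ?nnegrE ?mulr_ge0//; lra.
Qed.

Variables (P : pred (multi_index Omega)) (D tau lam : R).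
Hypotheses (D0 : 0 <= D) (lam0 : 0 < lam)
  (PD : forall s, P s -> (beta ^+ weight s) ^- 2 <= D)
  (Dtau : D ^+ 2 * tau <= lam ^+ 2).

(* P selects the low-degree indices; a high-degree coefficient enters the bound
   with a constant weight and is made small by the noise operator instead. *)
Definition cube_weight s : R := 4 * (~~ P s)%:R + 8 * lam.

Lemma cube_weight_ge0 s : 0 <= cube_weight s.
Proof. by rewrite addr_ge0 ?mulr_ge0// ltW. Qed.

(** Hypercontractivity bounds the fourth moment of the low part by [(D A)^2], where [A] is its
    squared norm. One factor [A] is at most [tau], so [D^2 tau <= lam^2] leaves [lam^2 A], still
    linear in the squared coefficients. *)
Lemma fexp_cube a : (forall w, `|fexp a w| <= 1) ->
  \sum_(s | P s) a s ^+ 2 <= tau ->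
  expect (fun w => `|fexp a w| ^+ 3) <= \sum_s cube_weight s * a s ^+ 2.
Proof.
move=> a1 atau.
pose lo s := a s * (P s)%:R; pose hi s := a s * (~~ P s)%:R.
have aE w : fexp a w = fexp lo w + fexp hi w.
  rewrite -big_split/=; apply: eq_bigr => s _; rewrite /lo /hi.
  by case: (P s) => /=; ring.
pose A := \sum_s lo s ^+ 2.
have AE : A = \sum_(s | P s) a s ^+ 2.
  rewrite [RHS]big_mkcond; apply: eq_bigr => s _; rewrite /lo.
  by case: (P s); rewrite ?mulr1// mulr0 expr0n.
have A0 : 0 <= A by apply: sumr_ge0 => s _; exact: sqr_ge0.
have E2 b : expect (fun w => fexp b w ^+ 2) = \sum_s b s ^+ 2.
  rewrite -[RHS](expect_fexpM X_basis).
  by apply: eq_expect => w; rewrite expr2.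
have E4 : expect (fun w => fexp lo w ^+ 4) <= (D * A) ^+ 2.
  apply: fexp_moment4_low => // s; rewrite /lo; case Ps: (P s) => //=.
    by move=> _; exact: PD.
  by rewrite mulr0 eqxx.
apply: (@le_trans _ _ (expect (fun w => 4 * fexp hi w ^+ 2 +
    (4 * lam * fexp lo w ^+ 2 + 4 / lam * fexp lo w ^+ 4)))).
  apply: expect_le => // w.
  apply: le_trans (cube_le_split (a1 w) (aE w) lam0) _.
  by rewrite le_eqVlt; apply/orP; left; apply/eqP; field; rewrite gt_eqF.
rewrite !expectD !expectZ !E2.
apply: (@le_trans _ _ (4 * \sum_s hi s ^+ 2 + 8 * lam * A)).
  rewrite lerD2l -/A.
  have DA : (D * A) ^+ 2 <= lam ^+ 2 * A.
    rewrite exprMn [A ^+ 2]expr2 mulrA ler_wpM2r//.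
    by apply: le_trans Dtau; rewrite ler_wpM2l ?sqr_ge0// AE.
  have : 4 / lam * expect (fun w => fexp lo w ^+ 4) <= 4 / lam * (lam ^+ 2 * A).
    by rewrite ler_wpM2l ?divr_ge0 ?(ltW lam0)// (le_trans E4).
  rewrite (_ : 4 / lam * (lam ^+ 2 * A) = 4 * lam * A); last by field; rewrite gt_eqF.
  lra.
rewrite /A !mulr_sumr -big_split/=; apply: ler_sum => s _.
rewrite /cube_weight /hi /lo; have := sqr_ge0 (a s); have := lam0.
case: (P s) => /=; rewrite ?mulr1 ?mulr0 ?expr0n/=; nra.
Qed.

Variables (rho M : R) (Psi : R -> R -> R).
Hypotheses (rho01 : 0 <= rho <= 1) (M0 : 0 <= M) (PsiM : step_bound Psi rho M).
Notation pair_expect := (pair_expect mu rho).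

(** Averaging out [k] splits [a] into parts with disjoint supports: [a1] is the increment, paid for
    now, and [a0] goes to the induction hypothesis. The payments therefore fit in one sum over [s],
    whatever the length of [l]. *)
Lemma pair_expect_seq l a : (forall w, 0 <= fexp a w <= 1) ->
  (forall k, \sum_(s | P s && (val (s k) != 0%N)) a s ^+ 2 <= tau) ->
  let b := fun s => a s * (all (fun k => val (s k) == 0%N) l)%:R in
  pair_expect (fun w w' => Psi (fexp a w) (fexp a w')) <=
  pair_expect (fun w w' => Psi (fexp b w) (fexp b w')) +
  2 * M * \sum_s cube_weight s * a s ^+ 2.
Proof.
elim: l a => [|k l IH] a a01 atau /=.
  rewrite (_ : fexp (fun s => a s * 1) = fexp a).
    rewrite lerDl mulr_ge0 ?mulr_ge0//; apply: sumr_ge0 => s _.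
    by rewrite mulr_ge0 ?sqr_ge0 ?cube_weight_ge0.
  by apply: eq_fexp => s; rewrite mulr1.
pose a0 s := a s * (val (s k) == 0%N)%:R.
pose a1 s := a s * (val (s k) != 0%N)%:R.
have avgE : avg mu k (fexp a) = fexp a0.
  by apply/funext => w; rewrite (avg_fexp X_basis).
have a001 w : 0 <= fexp a0 w <= 1 by rewrite -avgE; exact: avg_itv.
have a1E w : fexp a1 w = fexp a w - avg mu k (fexp a) w.
  rewrite avgE -sumrB; apply: eq_bigr => s _; rewrite /a0 /a1.
  by case: eqP => /= _; ring.
have a0le s : a0 s ^+ 2 <= a s ^+ 2.
  by rewrite /a0; case: eqP => _; rewrite ?mulr1// mulr0 expr0n/= sqr_ge0.
have := IH a0 a001 _ => /(_ _)/=.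
have -> : fexp (fun s => a0 s * (all (fun k => val (s k) == 0%N) l)%:R) =
  fexp (fun s => a s * ((val (s k) == 0%N) && all (fun k => val (s k) == 0%N) l)%:R).
  by apply: eq_fexp => s; rewrite /a0 -mulrA -natrM mulnb.
move=> IHa0.
apply: le_trans (pair_expect_step mu_prob rho01 PsiM k a01) _.
rewrite avgE.
have cube : cube_increment mu k (fexp a) <= \sum_s cube_weight s * a1 s ^+ 2.
  rewrite /cube_increment.
  have -> : expect (fun w => `|fexp a w - avg mu k (fexp a) w| ^+ 3) =
      expect (fun w => `|fexp a1 w| ^+ 3) by apply: eq_expect => w; rewrite a1E.
  apply: fexp_cube.
    move=> w; rewrite a1E avgE ler_norml.
    by have /andP[? ?] := a01 w; have /andP[? ?] := a001 w; apply/andP; split; lra.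
  apply: le_trans (atau k); rewrite big_mkcondr/=; apply: ler_sum => s _.
  by rewrite /a1; case: eqP => _ /=; rewrite ?mulr1// mulr0 expr0n.
apply: le_trans (lerD (IHa0 _) (lexx _)) _.
  move=> j; apply: le_trans (atau j); apply: ler_sum => s _; exact: a0le.
rewrite -addrA lerD2l -mulrDr.
apply: ler_wpM2l; first by rewrite mulr_ge0.
apply: le_trans (lerD (lexx _) cube) _.
rewrite -big_split/=; apply: ler_sum => s _; rewrite /a0 /a1.
by case: eqP => _ /=; rewrite ?mulr1 ?mulr0 expr0n/= ?mulr0 ?addr0 ?add0r.
Qed.

Lemma pair_expect_fexp a : (forall w, 0 <= fexp a w <= 1) ->
  (forall k, \sum_(s | P s && (val (s k) != 0%N)) a s ^+ 2 <= tau) ->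
  pair_expect (fun w w' => Psi (fexp a w) (fexp a w')) <=
  Psi (expect (fexp a)) (expect (fexp a)) +
  2 * M * \sum_s cube_weight s * a s ^+ 2.
Proof.
move=> a01 atau; apply: le_trans (pair_expect_seq (enum 'I_n) a01 atau) _.
rewrite lerD2r; set b := fun s => _.
have bE w : fexp b w = expect (fexp a).
  rewrite (expect_fexp X_basis); apply: eq_bigr => s _; rewrite /b.
  have -> : all (fun k => val (s k) == 0%N) (enum 'I_n) = null_index s.
    apply/allP/forallP => [h i|h i _]; last exact: h.
    by apply: h; rewrite mem_enum.
  case: (boolP (null_index s)) => [s0|_]; last by rewrite mulr0 mul0r.
  by rewrite (basis_fun_null X_basis w s0) !mulr1.
rewrite (_ : pair_expect _ = pair_expect (fun w _ => Psi (expect (fexp a)) (expect (fexp a)))).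
  by rewrite (pair_expect_fst mu_prob) expect_cst.
by apply: eq_bigr => w _; apply: eq_bigr => w' _; rewrite !bE.
Qed.

End FourierMoments.

(** * Noise smoothing and the error term *)

Section Smoothing.
Variable R : realType.

(** In [1 - rho^k = (1 - rho) (1 + rho + ... + rho^(k-1))] each of the [k] summands is at least
    [rho^k]. *)
Lemma natrM_expr_le (rho : R) k : 0 <= rho < 1 ->
  k%:R * rho ^+ k * (1 - rho) <= 1 - rho ^+ k.
Proof.
move=> /andP[r0 r1]; elim: k => [|k IH]; first by rewrite !mul0r expr0 subrr.
have rk : rho ^+ k.+1 <= 1 by rewrite exprn_ile1// ltW.
have : rho * (k%:R * rho ^+ k * (1 - rho)) <= rho * (1 - rho ^+ k).
  by rewrite ler_wpM2l.
have : 0 <= (1 - rho) * (1 - rho ^+ k.+1) by rewrite mulr_ge0 ?subr_ge0// ltW.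
rewrite -natr1 exprS; move: (rho ^+ k) (k%:R) => p q; nra.
Qed.

Lemma bernoulli_le (g : R) k : 0 <= g <= 1 -> 1 - g ^+ k <= k%:R * (1 - g).
Proof.
move=> /andP[g0 g1]; elim: k => [|k IH]; first by rewrite expr0 subrr mul0r.
have gk : 0 <= g ^+ k <= 1 by rewrite exprn_ge0// exprn_ile1.
rewrite -natr1 exprS; move: (g ^+ k) (k%:R) gk IH => p q /andP[? ?]; nra.
Qed.

(* k rho^k <= 1 / (1 - rho), which is where the factor 1 / (1 - rho) of the error
   term comes from. *)
Lemma smoothing_loss (rho g : R) k : 0 <= rho < 1 -> 0 <= g <= 1 ->
  rho ^+ k <= rho ^+ k * (g ^+ k) ^+ 2 + 2 * (1 - g) / (1 - rho).
Proof.
move=> /[dup] r01 /andP[r0 r1] /[dup] g01 /andP[g0 g1].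
have h1 := natrM_expr_le k r01.
have h2 : 1 - (g ^+ k) ^+ 2 <= 2 * (k%:R * (1 - g)).
  have := bernoulli_le (k * 2) g01; rewrite exprM natrM; lra.
have rk0 : 0 <= rho ^+ k by rewrite exprn_ge0.
have h3 : rho ^+ k * (1 - (g ^+ k) ^+ 2) <= rho ^+ k * (2 * (k%:R * (1 - g))).
  by rewrite ler_wpM2l.
have h4 : k%:R * rho ^+ k <= (1 - rho)^-1.
  rewrite -[leRHS]mul1r ler_pdivlMr ?subr_gt0//; lra.
have h5 : 2 * (1 - g) * (k%:R * rho ^+ k) <= 2 * (1 - g) * (1 - rho)^-1.
  by rewrite ler_wpM2l// mulr_ge0// subr_ge0.
lra.
Qed.

Lemma ln2_ge : 1 / 2 <= ln 2 :> R.
Proof.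
have h : expR (1 / 2) <= 2 :> R.
  have := @expR_ge1Dx R (- (1 / 2)); rewrite expRN => h.
  rewrite -[leRHS]invrK -[leLHS]invrK lef_pV2 ?posrE ?invr_gt0 ?expR_gt0//.
  by lra.
by rewrite -ler_expR lnK// posrE.
Qed.

End Smoothing.

(** * The stability bound with free parameters *)

Section StabilityCore.
Variables (R : realType) (n : nat) (Omega : 'I_n -> finType).
Variable mu : forall i, Omega i -> R.
Arguments mu : clear implicits.
Hypothesis mu_prob : forall i, is_fin_prob (mu i).
Variable X : forall i, 'I_#|Omega i| -> Omega i -> R.
Arguments X : clear implicits.
Hypothesis X_basis : forall i, is_orthonormal_basis (mu i) (X i).
Notation expect := (expect mu).
Notation fexp := (fexp X).
Implicit Types (c : multi_index Omega -> R).

Lemma noise_op_itv (g : R) f : 0 <= g <= 1 -> (forall w, 0 <= f w <= 1) ->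
  forall w, 0 <= noise_op mu g f w <= 1.
Proof.
move=> g01 f01 w.
have k0 w' : 0 <= noise_kernel mu g w w'.
  by apply: prodr_ge0 => i _; exact: (nker_ge0 mu_prob g01).
apply/andP; split.
  by apply: sumr_ge0 => w' _; rewrite mulr_ge0//; have /andP[] := f01 w'.
rewrite -(noise_kernel_sum mu_prob g w); apply: ler_sum => w' _.
by rewrite ler_piMr//; have /andP[] := f01 w'.
Qed.

Lemma noise_stability_pair rho f : noise_stability mu rho f =
  pair_expect mu rho (fun w w' => f w * f w').
Proof.
apply: eq_bigr => w _; rewrite /noise_op !mulr_sumr; apply: eq_bigr => w' _.
by ring.
Qed.

Lemma noise_stability_le_expect rho f : 0 <= rho <= 1 ->
  (forall w, 0 <= f w <= 1) -> noise_stability mu rho f <= expect f.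
Proof.
move=> r01 f01; apply: expect_le => // w.
have /andP[? ?] := noise_op_itv r01 f01 w; have /andP[? ?] := f01 w.
by rewrite ler_piMr.
Qed.

Lemma expect_itv f : (forall w, 0 <= f w <= 1) -> 0 <= expect f <= 1.
Proof.
move=> f01; apply/andP; split.
  by apply: expect_ge0 => // w; have /andP[] := f01 w.
rewrite -(expect_cst mu_prob 1); apply: expect_le => // w.
by have /andP[] := f01 w.
Qed.

Lemma sum_coef_sqr_le1 c : (forall w, 0 <= fexp c w <= 1) ->
  \sum_s c s ^+ 2 <= 1.
Proof.
move=> f01.
have -> : \sum_s c s ^+ 2 = expect (fun w => fexp c w * fexp c w).
  by rewrite (expect_fexpM X_basis); apply: eq_bigr => s _; rewrite expr2.
rewrite -[leRHS](expect_cst mu_prob 1); apply: expect_le => // w.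
by have /andP[? ?] := f01 w; rewrite mulr_ile1.
Qed.

Lemma noise_stability_smooth c rho g : 0 <= rho < 1 -> 0 <= g <= 1 ->
  (forall w, 0 <= fexp c w <= 1) ->
  noise_stability mu rho (fexp c) <=
  noise_stability mu rho (fexp (fun s => c s * g ^+ weight s)) +
  2 * (1 - g) / (1 - rho).
Proof.
move=> r01 g01 f01; rewrite !(noise_stability_fexp X_basis).
have c1 := sum_coef_sqr_le1 f01.
set b := 2 * (1 - g) / (1 - rho).
have b0 : 0 <= b.
  case/andP: r01 => ? ?; case/andP: g01 => ? ?.
  by rewrite divr_ge0 ?mulr_ge0 ?subr_ge0// ltW.
apply: (@le_trans _ _ (\sum_s ((c s * g ^+ weight s) ^+ 2 * rho ^+ weight s +
    b * c s ^+ 2))).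
  apply: ler_sum => s _.
  have := ler_wpM2l (sqr_ge0 (c s)) (smoothing_loss (weight s) r01 g01).
  rewrite -/b => /le_trans; apply.
  by rewrite le_eqVlt; apply/orP; left; apply/eqP; ring.
by rewrite big_split/= lerD2l -mulr_sumr ler_piMr.
Qed.

Variables (c : multi_index Omega -> R) (alpha L rho g e M : R) (Psi : R -> R -> R).
Hypotheses (f01 : forall w, 0 <= fexp c w <= 1) (alpha0 : 0 < alpha)
  (alpha1 : alpha <= 1 / 2) (mu_alpha : forall i x, alpha <= mu i x) (L0 : 0 < L).
Let K := ln alpha^-1.
Hypotheses (low : forall i, low_degree_influence c (L / K) i <= expR (- L))
  (rho01 : 0 <= rho < 1) (g01 : 0 <= g <= 1) (M0 : 0 <= M)
  (PsiM : step_bound Psi rho M)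
  (Psi_ge : forall x y, 0 <= x <= 1 -> 0 <= y <= 1 -> x * y <= Psi x y + 2 * e).

Lemma ln_inv_ge : ln 2 <= K.
Proof.
rewrite /K ler_ln ?posrE ?invr_gt0// -[leLHS]invrK lef_pV2 ?posrE ?invr_gt0//.
by have := alpha1; lra.
Qed.

Lemma noise_stability_core :
  noise_stability mu rho (fexp c) <=
  Psi (expect (fexp c)) (expect (fexp c)) + 2 * e + 2 * (1 - g) / (1 - rho) +
  2 * M * (4 * expR (- (2 * (1 - g) * (L / (12 * K)))) + 8 * expR (- (L / 4))).
Proof.
have K2 := ln_inv_ge; have l2 := @ln2_ge R.
have K0 : 0 < K by apply: lt_le_trans K2; lra.
have r01 : 0 <= rho <= 1 by case/andP: rho01 => -> /ltW ->.
have [g0 g1] := andP g01.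
pose a s := c s * g ^+ weight s.
have hE w : fexp a w = noise_op mu g (fexp c) w by rewrite (noise_op_fexp X_basis).
have a01 w : 0 <= fexp a w <= 1 by rewrite hE; exact: noise_op_itv.
have gw (s : multi_index Omega) : 0 <= g ^+ weight s <= 1 by rewrite exprn_ge0// exprn_ile1.
have ac s : a s ^+ 2 <= c s ^+ 2.
  rewrite /a exprMn ler_piMr ?sqr_ge0//; have /andP[? ?] := gw s.
  by rewrite exprn_ile1.
(* On degree [w], undoing the noise costs [(4 / alpha)^w = exp (w (ln 4 + K)) <= exp (3 K w)],
   because [ln 4 <= 2 K]. The cutoff keeps this below [D = exp (L / 4)]. *)
pose d := L / (12 * K).
pose P (s : multi_index Omega) := ((weight s)%:R <= d)%R.
pose beta := Num.sqrt alpha / 2.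
have beta0 : 0 < beta by rewrite divr_gt0 ?sqrtr_gt0.
have beta2 : beta ^+ 2 = alpha / 4.
  by rewrite expr_div_n sqr_sqrtr ?(ltW alpha0)//; congr (_ / _); ring.
(* With [tau = exp (- L)], these choices make [D^2 tau] equal to [lam^2]. *)
pose lam := expR (- (L / 4)).
pose D := expR (L / 4).
have PD s : P s -> (beta ^+ weight s) ^- 2 <= D.
  rewrite /P => sd; rewrite -exprM mulnC exprM beta2 -exprVn.
  have -> : (alpha / 4)^-1 = expR (ln 4 + K).
    rewrite expRD !lnK ?posrE ?invr_gt0//; field.
    by rewrite gt_eqF.
  rewrite -expRM_natl /D ler_expR.
  have l4 : ln 4 <= 2 * K.
    have -> : (4 : R) = 2 * 2 by ring.
    by rewrite lnM ?posrE//; lra.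
  apply: (@le_trans _ _ (d * (3 * K))).
    have l40 : 0 <= ln (4 : R) by rewrite ln_ge0//; lra.
    by apply: ler_pM => //; lra.
  by rewrite le_eqVlt; apply/orP; left; apply/eqP; rewrite /d; field; rewrite gt_eqF.
have Dtau : D ^+ 2 * expR (- L) <= lam ^+ 2.
  by rewrite /D /lam -!expRM_natl -expRD ler_expR; lra.
have alow k : \sum_(s | P s && (val (s k) != 0%N)) a s ^+ 2 <= expR (- L).
  apply: le_trans (low k).
  rewrite big_mkcond [leRHS]big_mkcond; apply: ler_sum => s _.
  case: ifP => [/andP[sd sk]|_]; last by case: ifP => // _; exact: sqr_ge0.
  rewrite lt0n sk andbT ifT//; apply: le_trans sd _.
  rewrite /d ler_pM2l// lef_pV2 ?posrE ?mulr_gt0//; lra.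
have alpha1' : alpha <= 1 by have := alpha1; lra.
have main := pair_expect_fexp mu_prob X_basis alpha0 alpha1' mu_alpha beta0 beta2
  (expR_ge0 (L / 4)) (expR_gt0 (- (L / 4))) PD Dtau r01 M0 PsiM a01 alow.
(* Smoothing leaves the mean unchanged, since the null index has weight 0. *)
have EaE : expect (fexp a) = expect (fexp c).
  rewrite !(expect_fexp X_basis); apply: eq_bigr => s _.
  case: (boolP (null_index s)) => [/forallP s0|_]; last by rewrite !mulr0.
  rewrite /a (_ : weight s = 0%N) ?expr0 ?mulr1//.
  by apply: eq_card0 => i; rewrite !inE; apply/negP; rewrite lt0n s0.
rewrite EaE in main.
have stab : noise_stability mu rho (fexp a) <=
    pair_expect mu rho (fun w w' => Psi (fexp a w) (fexp a w')) + 2 * e.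
  rewrite noise_stability_pair -[X in _ + X](expect_cst mu_prob).
  rewrite -(pair_expect_fst mu_prob rho) -pair_expectD.
  by apply: pair_expect_le => // w w'; exact: Psi_ge.
set E1 := expR (- (2 * (1 - g) * (L / (12 * K)))).
have tail : \sum_s cube_weight P lam s * a s ^+ 2 <= 4 * E1 + 8 * lam.
  have E0 : 0 <= 4 * E1 + 8 * lam.
    by rewrite addr_ge0// mulr_ge0 ?expR_ge0.
  have c1 := sum_coef_sqr_le1 f01.
  apply: (@le_trans _ _ (\sum_s (4 * E1 + 8 * lam) * c s ^+ 2)); last first.
    by rewrite -mulr_sumr ler_piMr.
  apply: ler_sum => s _; rewrite /cube_weight mulrDl [leRHS]mulrDl; apply: lerD.
    case: (boolP (P s)) => Ps /=.
      by rewrite mulr0 mul0r mulr_ge0 ?sqr_ge0// mulr_ge0 ?expR_ge0.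
    rewrite mulr1 -[leRHS]mulrA ler_wpM2l// /a exprMn mulrC ler_wpM2r ?sqr_ge0//.
    (* Above the cutoff, [g^(2 w) <= exp (- 2 (1 - g) w) <= exp (- 2 (1 - g) d)]. *)
    have gexp : g <= expR (- (1 - g)).
      by apply: le_trans (expR_ge1Dx _); lra.
    apply: (@le_trans _ _ (expR (- (1 - g)) ^+ (weight s * 2))).
      by rewrite -exprM lerXn2r ?nnegrE ?expR_ge0.
    rewrite -expRM_natl /E1 ler_expR natrM.
    have wd : d <= (weight s)%:R by move: Ps; rewrite /P -ltNge => /ltW.
    have g2 : 0 <= 2 * (1 - g) by rewrite mulr_ge0// subr_ge0.
    have := ler_wpM2l g2 wd; rewrite -/d; lra.
  by rewrite ler_wpM2l ?mulr_ge0 ?expR_ge0.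
have M2 : 0 <= 2 * M by rewrite mulr_ge0.
have tailM := ler_wpM2l M2 tail.
have smooth := noise_stability_smooth rho01 g01 f01.
move: main stab tailM smooth; rewrite -/a -/lam.
move: (Psi _ _) (pair_expect _ _ _) (2 * M * _) (2 * M * _) (noise_stability _ _ _)
  (noise_stability _ _ _) (2 * (1 - g) / _) (2 * e) => x1 x2 x3 x4 x5 x6 x7 x8.
lra.
Qed.

End StabilityCore.

(** * Choice of the parameters *)

Section ErrorTerm.
Variable R : realType.


Lemma loglog_inv_ge (tau : R) : 0 < ln tau^-1 -> let L := ln tau^-1 in
  let E := expR (loglog_inv tau) in
  [/\ 1 <= loglog_inv tau, L <= E &
      E ^+ 7 * expR (- (L / 4)) <= (28 + expR 1) ^+ 7].
Proof.
move=> L0 L E; rewrite -/L in L0; split.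
- by rewrite le_max lexx.
- rewrite -[leLHS](lnK (_ : L \is Num.pos)) ?posrE// ler_expR.
  by rewrite le_max lexx orbT.
(* [28 = 4 * 7], so that the seventh power has the factor [exp (L / 4)]. *)
have E1 : E <= (28 + expR 1) * expR (L / 28).
  have LE : L <= 28 * expR (L / 28) by have := @expR_ge1Dx R (L / 28); lra.
  have e1 : expR 1 <= expR 1 * expR (L / 28) :> R.
    by rewrite ler_peMr ?expR_ge0// -[leLHS]expR0 ler_expR divr_ge0// ltW.
  have := expR_gt0 (L / 28); have := expR_gt0 (1 : R).
  rewrite mulrDl /E /loglog_inv maxEle -/L; case: ifP => _ p1 p2.
    by rewrite lnK ?posrE//; nra.
  nra.
have e28 : 0 <= 28 + expR 1 :> R by rewrite addr_ge0 ?expR_ge0.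
apply: (@le_trans _ _ (((28 + expR 1) * expR (L / 28)) ^+ 7 * expR (- (L / 4)))).
  by rewrite ler_wpM2r ?expR_ge0// lerXn2r ?nnegrE ?mulr_ge0 ?expR_ge0.
rewrite exprMn -expRM_natl -mulrA -expRD.
by rewrite (_ : 7 * _ + _ = 0) ?expR0 ?mulr1//; field.
Qed.

(** Here [r] is [1 - rho]. The shift contributes [2 e] twice, for the product and for [Gamma];
    [2 eta / r] is the smoothing loss and the rest is the Taylor remainder. Each is a multiple of
    [err] or of [E^-1 <= 2 err]. *)
Lemma total_error_le (C0 C2 K r L l : R) : 0 < C0 -> 0 <= C2 -> 1 / 2 <= K ->
  0 < r <= 1 -> 0 < L -> 1 <= l -> L <= expR l ->
  expR l ^+ 7 * expR (- (L / 4)) <= C2 ->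
  let err := K / r * (l / L) in
  let eta := 48 * (K * (l / L)) in
  let e := (4 * expR l)^-1 in
  let M := C0 / (e ^+ 4 * r ^+ 2) in
  err <= 1 / 96 ->
  0 <= eta <= 1 /\
  4 * e + 2 * eta / r +
    2 * M * (4 * expR (- (2 * eta * (L / (12 * K)))) + 8 * expR (- (L / 4))) <=
  (96 + 2 * (1 + 2048 * C0 + 4096 * C0 * C2)) * err.
Proof.
move=> C00 C20 K2 /andP[r0 r1] L0 l1 LE EC2 err eta e M err1.
set E := expR l in LE EC2 *; set lam := expR (- (L / 4)) in EC2 *.
have E0 : 0 < E := expR_gt0 _.
have K0 : 0 < K by lra.
have l0 : 0 < l by lra.
have lL0 : 0 < l / L by rewrite divr_gt0.
have err0 : 0 <= err by rewrite mulr_ge0 ?divr_ge0// ltW.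
have etaE : eta = 48 * (r * err).
  by rewrite /eta /err; field; rewrite !gt_eqF.
have errL : err * L = K * l / r by rewrite /err; field; rewrite !gt_eqF.
have etar : 2 * eta / r = 96 * err by rewrite etaE; field; rewrite gt_eqF.
have eE : 4 * e = E^-1 by rewrite /e -/E; field; rewrite gt_eqF.
have ME : M = 256 * C0 * (E ^+ 4 * r^-1 ^+ 2).
  by rewrite /M /e -/E; field; rewrite !gt_eqF.
(* The 48 in [eta] is chosen for this exponent: [2 * 48 / 12 = 8], which exceeds the power 6 in the
   bound on [M]. *)
have -> : expR (- (2 * eta * (L / (12 * K)))) = E ^- 8.
  rewrite (_ : 2 * eta * _ = 8 * l); last by rewrite /eta; field; rewrite !gt_eqF.
  by rewrite expRN expRM_natl.
have E1 : 1 <= E by rewrite -[leLHS]expR0 ler_expR ltW.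
have lam0 : 0 <= lam := expR_ge0 _.
rewrite eE etar.
clearbody M e eta err lam E.
have rerr : r * err <= err by rewrite ler_piMl.
have rerr0 : 0 <= r * err by rewrite mulr_ge0// ltW.
split; first by rewrite etaE; apply/andP; split; lra.
have Kl : 1 / 2 <= K * l by nra.
have rV0 : 0 <= r^-1 by rewrite invr_ge0 ltW.
have rV : 1 <= r^-1 by rewrite invf_ge1.
have rKl : 1 / 2 * r^-1 <= K * l / r by apply: ler_wpM2r.
(* [1 / (2 r) <= K l / r = err L <= L / 96]: a small error keeps [rho] away from 1. *)
have rVE : r^-1 <= E.
  have : err * L <= 1 / 96 * L by apply: ler_wpM2r => //; exact: ltW.
  rewrite errL; lra.
have EV0 : 0 <= E^-1 by rewrite invr_ge0 ltW.
have EV : E^-1 <= 2 * err.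
  apply: (@le_trans _ _ L^-1); first by rewrite lef_pV2 ?posrE.
  rewrite -[leLHS]mul1r ler_pdivrMr// -mulrA errL; lra.
have M6 : M <= 256 * C0 * E ^+ 6.
  have -> : E ^+ 6 = E ^+ 4 * E ^+ 2 by rewrite -exprD.
  rewrite ME; apply: ler_wpM2l; first by lra.
  apply: ler_wpM2l; first by rewrite exprn_ge0// ltW.
  by apply: lerXn2r => //; rewrite nnegrE// ltW.
have t1 : E ^+ 6 * E ^- 8 <= E^-1.
  rewrite (_ : _ * _ = E^-1 * E^-1); last by field; rewrite gt_eqF.
  by apply: ler_piMl => //; rewrite invf_le1.
have t2 : E ^+ 6 * lam <= C2 * E^-1.
  by rewrite ler_pdivlMr// mulrAC -exprSr.
have C512 : 0 <= 512 * C0 by lra.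
have tot : 2 * M * (4 * E ^- 8 + 8 * lam) <= 512 * C0 * (4 * E^-1 + 8 * (C2 * E^-1)).
  apply: (@le_trans _ _ (2 * (256 * C0 * E ^+ 6) * (4 * E ^- 8 + 8 * lam))).
    apply: ler_wpM2r; last by apply: ler_wpM2l.
    by apply: addr_ge0; apply: mulr_ge0; rewrite // invr_ge0 exprn_ge0 ?(ltW E0).
  have -> : 2 * (256 * C0 * E ^+ 6) * (4 * E ^- 8 + 8 * lam) =
      512 * C0 * (4 * (E ^+ 6 * E ^- 8) + 8 * (E ^+ 6 * lam)) by ring.
  by apply: ler_wpM2l => //; apply: lerD; apply: ler_wpM2l.
have c0 : 0 <= 1 + 2048 * C0 + 4096 * C0 * C2.
  have : 0 <= C0 * C2 by apply: mulr_ge0 => //; exact: ltW.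
  lra.
have := ler_wpM2l c0 EV.
move: tot; have -> : 512 * C0 * (4 * E^-1 + 8 * (C2 * E^-1)) =
  (1 + 2048 * C0 + 4096 * C0 * C2) * E^-1 - E^-1 by ring.
move: (2 * M * _) (1 + _ + _) => x y; lra.
Qed.

End ErrorTerm.

Theorem theorem4p4 (R : realType) :
  exists2 C : R, 0 < C &
  forall (n : nat) (Omega : 'I_n -> finType) (mu : forall i, Omega i -> R)
    (f : prod_space Omega -> R) (alpha tau rho : R)
    (X : forall i, 'I_#|Omega i| -> Omega i -> R) (c : multi_index Omega -> R),
  (forall i, is_fin_prob (mu i)) ->
  (forall w, 0 <= f w <= 1) ->
  0 < alpha <= 1 / 2 ->
  (forall i x, alpha <= mu i x) ->
  let K := ln alpha^-1 in
  0 < tau < 1 / 2 ->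
  (forall i, is_orthonormal_basis (mu i) (X i)) ->
  is_expansion X c f ->
  (forall i, low_degree_influence c (ln tau^-1 / K) i <= tau) ->
  0 <= rho < 1 ->
  noise_stability mu rho f <=
    Gamma rho (expect mu f)
    + C * (K / (1 - rho)) * (loglog_inv tau / ln tau^-1).
Proof.
have [C0 C00 bellman] := gaussian_bellman R.
pose C2 : R := (28 + expR 1) ^+ 7.
have C20 : 0 <= C2 by rewrite exprn_ge0// addr_ge0 ?expR_ge0.
pose C := 96 + 2 * (1 + 2048 * C0 + 4096 * C0 * C2).
have C96 : 96 <= C.
  have : 0 <= C0 * C2 by apply: mulr_ge0 => //; exact: ltW.
  rewrite /C; lra.
exists C => [|n Omega mu f alpha tau rho X c mu_prob f01 /andP[alpha0 alpha1]
  mu_alpha K /andP[tau0 tau1] X_basis fE low /[dup] rho01 /andP[rho0 rho1]].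
  by apply: lt_le_trans C96.
set L := ln tau^-1 in low *; set l := loglog_inv tau.
have rho01' : 0 <= rho <= 1 by rewrite rho0 ltW.
have L0 : 0 < L by rewrite ln_gt0// invf_gt1//; lra.
have [l1 LE EC2] := loglog_inv_ge L0.
have K2 : 1 / 2 <= K.
  apply: le_trans (ln2_ge R) _; apply: ln_inv_ge => //.
have fE' : f = fexp X c by apply/funext.
have m01 := expect_itv mu_prob f01.
set m := expect mu f in m01 *.
rewrite -[C * _ * _]mulrA; set err := _ / _ * _.
have C0' : 0 <= C by apply: le_trans C96; rewrite ler0n.
have errp : 0 <= err.
  apply: mulr_ge0; apply: divr_ge0; last exact: ltW.
  - by apply: le_trans K2; rewrite divr_ge0.
  - by rewrite subr_ge0 ltW.
  - exact: le_trans ler01 l1.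
have err0 : 0 <= C * err by apply: mulr_ge0.
have Sm : noise_stability mu rho f <= m by exact: noise_stability_le_expect.
(* At means 0 and 1 the quantile is infinite, but there [noise_stability <= m] already suffices. *)
have [m0|m0] := eqVneq m 0.
  by apply: le_trans Sm _; rewrite m0 addr_ge0// Gamma_ge0.
have [m1|m1] := eqVneq m 1.
  by apply: le_trans Sm _; rewrite m1 Gamma1 lerDl.
have mi : 0 < m < 1 by rewrite !lt_neqAle eq_sym m0 m1.
(* An error term of at least 1 makes the claim trivial. Otherwise [C >= 96] gives [err <= 1 / 96],
   the smallness that the choice of parameters needs. *)
have [big|small] := lerP 1 (C * err).
  apply: (@le_trans _ _ 1); first by apply: le_trans Sm _; case/andP: m01.
  by apply: (le_trans big); rewrite lerDr Gamma_ge0.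
have err96 : err <= 1 / 96.
  have : 96 * err <= C * err by apply: ler_wpM2r.
  lra.
have r01 : 0 < 1 - rho <= 1 by rewrite subr_gt0 rho1/= gerBl.
have [] := total_error_le C00 C20 K2 r01 L0 l1 LE EC2 err96.
set eta := 48 * _; set e := (4 * _)^-1; set M := C0 / _ => eta01 total.
have e01 : 0 < e <= 1 / 4.
  have l0 : 0 <= l by exact: le_trans ler01 l1.
  have E1 : 1 <= expR l by rewrite -[leLHS]expR0 ler_expR.
  rewrite invr_gt0 mul1r lef_pV2 ?posrE ?mulr_gt0 ?expR_gt0//=.
  by rewrite -[leLHS]mulr1; apply: ler_wpM2l E1; exact: ler0n.
have [Psi [PsiM Psi_ge PsiG]] := bellman rho e rho01 e01.
have M0 : 0 <= M.
  by rewrite divr_ge0 ?(ltW C00)// mulr_ge0 ?sqr_ge0// exprn_even_ge0.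
have tauE : tau = expR (- L) by rewrite /L lnV ?posrE// opprK lnK ?posrE.
have g01 : 0 <= 1 - eta <= 1.
  by case/andP: eta01 => ? ?; rewrite subr_ge0 gerBl; apply/andP.
rewrite fE' in f01 *; rewrite tauE in low.
have := noise_stability_core mu_prob X_basis f01 alpha0 alpha1 mu_alpha L0 low
  rho01 g01 M0 PsiM Psi_ge.
rewrite -fE' -/m subKr => core.
have := PsiG m mi.
move: core total; rewrite -/err -/C.
move: (noise_stability _ _ _) (Psi m m) (Gamma _ _) (2 * eta / _) (2 * M * _)
  (C * err) => x1 x2 x3 x4 x5 x6.
lra.
Qed.
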